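(* Let $\mathcal S$ be the node-moving closure of the explicit seeds listed in the context, let $\mathcal S_n=\{\lambda\in\mathcal S:|\lambda|=n\}$, and let $p(n)$ be the partition number (the number of partitions of $n$). Then $$\frac{|\mathcal S_n|}{p(n)}\longrightarrow0\qquad(n\to\infty).$$ More quantitatively, $$\frac{|\mathcal S_n|}{p(n)}\le\exp\left[-\pi\left(\sqrt{\tfrac23}-\tfrac23\right)\sqrt n+O(\log n)\right].$$ The same conclusion holds even if one optimistically grants permanental dominance for every rectangular-tail shape $(a,k^r,2^s,1^t)$ and all of its node-moving descendants, that is, even if all these shapes and their node-moving descendants are added to $\mathcal S$.
   Context: For a partition $\lambda\vdash n$ with irreducible character $\chi^\lambda$ of the symmetric group $S_n$ and $f^\lambda=\chi^\lambda(1)$, permanental dominance for $\lambda$ is the statement that $\frac{1}{f^\lambda}\sum_{\sigma\in S_n}\chi^\lambda(\sigma)\prod_{i=1}^n a_{i,\sigma(i)}\le \operatorname{per}(A)$ for every complex Hermitian positive-semidefinite $n\times n$ matrix $A=(a_{ij})$, where $\operatorname{per}$ is the permanent. A node move on a partition removes an outer (removable) box from a row of length greater than one and appends a new row of length one; total size is preserved. The node-moving descendants of a partition are the partitions obtained from it by finite sequences of node moves, and the node-moving closure of a set of partitions consists of its members and all their node-moving descendants. In exponent notation $q^u$ means $u$ copies of the part $q$. For a nonempty partition $\rho$, $C(\rho)=\max\{\rho_i-i:\rho_i>\rho_{i+1}\}$ (with $\rho_{\ell+1}=0$ past the last part), the largest content (column index minus row index) of a removable box. The seeds are: (i) Pate's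 class, namely all partitions of the form $(p,q^u,r^v,2^s,1^t)$ with $0\le u\le2$ and $0\le v\le1$ ($s,t\ge0$); (ii) the family $(m,4,3,3)$, $m\ge4$; (iii) the finite results through order fifteen, i.e. all partitions of every $n\le15$, and the shape or shapes of order $17$ for which permanental dominance is established by the available order-$17$ exceptional certificate (a finite set of partitions of $17$); (iv) all partitions $(m,\rho)=(m,\rho_1,\rho_2,\dots)$ with $\rho$ a nonempty partition, $m\ge\rho_1$ and $m\ge|\rho|+C(\rho)-1$; (v) all $(a,b,3,3)$ with $a\ge b\ge4$ and $5a\ge8b$. *)

(* Defs.v *)
From HB Require Import structures.
From mathcomp Require Import all_boot all_order all_algebra finmap.
From mathcomp Require Import zify.
From mathcomp Require Import all_classical all_reals all_analysis.

Set Implicit Arguments.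
Unset Strict Implicit.
Unset Printing Implicit Defensive.

Import Order.TTheory GRing.Theory Num.Theory.

Local Open Scope classical_set_scope.
Local Open Scope nat_scope.

Definition is_partition (l : seq nat) : bool := sorted geq l && (0 \notin l).

Definition partitions_of (n : nat) : set (seq nat) :=
  [set l | is_partition l /\ sumn l = n].

Definition node_move (l l' : seq nat) : Prop :=
  exists i, [/\ i < size l, nth 0 l i.+1 < nth 0 l i, 1 < nth 0 l i &
    l' = rcons (set_nth 0 l i (nth 0 l i).-1) 1].

Inductive node_closure (A : set (seq nat)) : set (seq nat) :=
| node_closure_base l : A l -> node_closure A l
| node_closure_step l l' :
    node_closure A l -> node_move l l' -> node_closure A l'.

(* Rows are 0-based here, so row i has last content rho_i - (i + 1).  The last
   row of a nonempty partition is always removable, hence its content is a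
   legitimate default value for the maximum. *)
Definition max_removable_content (rho : seq nat) : int :=
  (\big[Num.max/((last 0 rho)%:Z - (size rho)%:Z)%R]_(i < size rho
      | (nth 0 rho i.+1 < nth 0 rho i)%N)
    ((nth 0 rho i)%:Z - i.+1%:Z)%R).

(* In the seeds given by a shape, is_partition forces the multiplied parts to
   be listed in weakly decreasing order and to be positive. *)
Definition pate_class : set (seq nat) :=
  [set l | is_partition l /\ exists p q r u v s t,
    [/\ u <= 2, v <= 1 &
      l = p :: nseq u q ++ nseq v r ++ nseq s 2 ++ nseq t 1]].

Definition family_m433 : set (seq nat) :=
  [set l | exists2 m, 4 <= m & l = [:: m; 4; 3; 3]].

Definition small_partitions : set (seq nat) :=
  [set l | is_partition l /\ sumn l <= 15].

Definition long_first_row : set (seq nat) :=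
  [set l | exists m rho,
    [/\ is_partition rho, rho != [::], head 0 rho <= m,
        ((sumn rho)%:Z + max_removable_content rho - 1 <= m%:Z)%R &
        l = m :: rho]].

Definition family_ab33 : set (seq nat) :=
  [set l | exists a b,
    [/\ b <= a, 4 <= b, 8 * b <= 5 * a & l = [:: a; b; 3; 3]]].

(* E17 stands for the shapes of order 17 covered by the certificate. *)
Definition seeds (E17 : set (seq nat)) : set (seq nat) :=
  pate_class `|` family_m433 `|` (small_partitions `|` E17)
  `|` long_first_row `|` family_ab33.

Definition rectangular_tail : set (seq nat) :=
  [set l | is_partition l /\ exists a k r s t,
    l = a :: nseq r k ++ nseq s 2 ++ nseq t 1].

Lemma finite_partitions_of n : finite_set (partitions_of n).
Proof.
pose f (s : n.-bseq 'I_n.+1) : seq nat := [seq val x | x <- s].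
apply: (@sub_finite_set _ _ (f @` setT)); last first.
  by apply: finite_image; exact: finite_finset.
move=> l [/andP[_ l0] ln].
have sz : size [seq inord x : 'I_n.+1 | x <- l] <= n.
  rewrite size_map -ln; elim: l l0 {ln} => //= x l IH.
  by rewrite inE negb_or => /andP[x0 /IH]; case: x x0 => // x _; lia.
exists (Bseq sz) => //; rewrite /f /= -map_comp.
rewrite -[RHS]map_id; apply/eq_in_map => x xl /=.
rewrite inordK // ltnS -ln; elim: l xl {l0 ln sz} => //= y l IH.
by rewrite inE => /orP[/eqP->|/IH]; lia.
Qed.

(* fset_set is the underlying finite set, as finite_partitions_of shows that
   A `&` partitions_of n is finite. *)
Definition count_of (A : set (seq nat)) (n : nat) : nat :=
  #|` fset_set (A `&` partitions_of n)|.

Definition partition_number (n : nat) : nat :=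
  #|` fset_set (partitions_of n)|.

Definition partition_ratio (R : realType) (A : set (seq nat)) (n : nat) : R :=
  ((count_of A n)%:R / (partition_number n)%:R)%R.

(* Main.v *)
Require Import Defs.
From mathcomp Require Import all_boot all_order all_algebra.
From mathcomp Require Import all_classical all_reals all_analysis.
From mathcomp Require Import finmap zify ring lra.
Import Order.TTheory GRing.Theory Num.Theory.
Import numFieldNormedType.Exports.
Local Open Scope classical_set_scope.
Local Open Scope ring_scope.

Set Implicit Arguments.
Unset Strict Implicit.
Unset Printing Implicit Defensive.

(* A node move only decreases a row and adds a part 1, so every descendant of
   (h, 2^s, 1^t) has the form (h', 2^s', 1^t') with h' <= h row by row.  The
   condition m >= |rho| + C(rho) - 1 forces |rho| <= 2(n + 1)/3 unless rho is
   a column, and for descendants of (a, k^r, 2^s, 1^t) either the part inside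
   the k x r box or its complement in the box has at most n/2 cells.  Hence for
   n > 17 an element of S' of size n is given by polynomially many parameters
   and a partition of size at most 2(n + 1)/3.

   Both p(n) <= e^(c sqrt n) and p(n) >= A n^-B e^(c sqrt n), c = 2 sqrt zeta(2),
   follow by induction from n p(n) = sum_(k, v >= 1) v p(n - k v) (Erdos), and
   only zeta(2) >= pi^2 / 6 is needed to conclude. *)

(** * The inequality [zeta(2) >= pi^2 / 6] *)

(** The error allowed in the exponent is O(log n), so p(n) must be bounded on both sides with the
    same c, up to a polynomial factor. Partitions of size at most 2(n + 1)/3 then give a ratio e^(-c
    (1 - q) sqrt n) up to powers of n, where q = sqrt(2/3). This decreases with c, so a lower bound
    on zeta(2) is enough, and c >= pi q turns the exponent into -pi (q - q^2) sqrt n, the constant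
    of the statement. The upper bound on p(n) only uses the tangent line of the square root. In the
    lower bound, the second-order term of the square root, the tail of zeta(2) and the truncation of
    the sums cost O(sqrt n) against the main term n of the recurrence; the factor n^-B wins this
    back once B is large. *)

Lemma le_of_derive_ge0 {R : realType} (f df : R -> R) (x : R) : 0 <= x ->
  (forall t, is_derive t (1 : R) f (df t)) ->
  (forall t, 0 <= t <= x -> 0 <= df t) -> f 0 <= f x.
Proof.
move=> x0 f_df df_ge0; have [|c] := @MVT_segment _ f df 0 x x0.
  by apply: derivable_within_continuous => t _; exact: ex_derive.
rewrite in_itv/= => cx fE.
by rewrite -subr_ge0 fE subr0 mulr_ge0// df_ge0.
Qed.

Lemma cos_mul_le_sin {R : realType} (x : R) :
  0 < x < pi / 2 -> x * cos x <= sin x.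
Proof.
move=> /andP[x0 xpi]; rewrite -subr_ge0.
pose f : R -> R := sin - id * cos.
rewrite -[leRHS]/(f x); have <- : f 0 = 0 by rewrite /f !fctE sin0 mul0r subr0.
apply: (@le_of_derive_ge0 _ _ (fun t => t * sin t)); first exact: ltW.
  move=> t; apply: is_derive_eq; rewrite /GRing.scale/=; ring.
move=> t /andP[t0 tx]; rewrite mulr_ge0// sin_ge0_pi// t0/=.
by have := pi_gt0 R; lra.
Qed.

(** Here 1/sin^2 = 1 + cot^2, and cot x <= 1/x by [cos_mul_le_sin]. *)
Lemma inv_sin_sqr_le {R : realType} (x : R) :
  0 < x < pi / 2 -> (sin x)^-2 <= x^-2 + 1.
Proof.
move=> x0pi; have s0 := sin_gt0_pihalf x0pi.
have := cos_mul_le_sin x0pi; have := cos2Dsin2 x.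
have c0 : 0 < cos x.
  by apply: cos_gt0_pihalf; have := pi_gt0 R; move: x0pi; lra.
case/andP: x0pi => x0 _; move: (sin x) (cos x) s0 c0 => s c s0 c0 cs xcs.
rewrite -lerBlDr (_ : s^-2 - 1 = (c / s) ^+ 2); last first.
  have c2 : c ^+ 2 = 1 - s ^+ 2 by rewrite -cs addrK.
  by rewrite expr_div_n c2; field; rewrite gt_eqF.
rewrite -exprVn ler_sqr ?nnegrE ?divr_ge0 ?invr_ge0 ?(ltW x0) ?(ltW s0) ?(ltW c0)//.
by rewrite ler_pdivrMr// mulrC ler_pdivlMr// mulrC.
Qed.

Lemma inv_sin_sqr_double {R : realType} (x : R) : 0 < x < pi / 2 ->
  (sin x)^-2 + (sin (pi / 2 - x))^-2 = 4 * (sin (2 * x))^-2.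
Proof.
move=> x0pi; have s0 := sin_gt0_pihalf x0pi.
have c0 : 0 < cos x.
  by apply: cos_gt0_pihalf; have := pi_gt0 R; move: x0pi; lra.
rewrite sinB sin_pihalf cos_pihalf mul1r mul0r subr0 [2 * x]mulr_natl sin_mulr2n.
have := cos2Dsin2 x; move: (sin x) (cos x) s0 c0 => s c s0 c0 cs.
have sN0 : s != 0 by rewrite gt_eqF.
have cN0 : c != 0 by rewrite gt_eqF.
rewrite (_ : s^-2 + c^-2 = (c ^+ 2 + s ^+ 2) / (c ^+ 2 * s ^+ 2)); last first.
  by field; rewrite sN0.
by rewrite cs; field; rewrite sN0.
Qed.

Lemma big_ord_pairs {R : realType} (f : nat -> R) n :
  \sum_(k < 2 * n) f k = \sum_(k < n) (f k + f (2 * n - k.+1)%N).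
Proof.
rewrite -!(big_mkord xpredT) (@big_cat_nat _ _ _ n)//=; last by rewrite leq_pmull.
rewrite big_split/= big_mkord; congr (_ + _).
rewrite [LHS]big_nat_rev/= -[X in \sum_(X <= _ < _) _ = _]add0n big_addn.
rewrite (_ : (2 * n - n = n)%N); last by lia.
by rewrite big_mkord; apply: eq_bigr => i _; congr f; have := ltn_ord i; lia.
Qed.

(** The odd multiples of pi / 2^(n+2) in ]0, pi/2[. The reflection x -> pi/2 - x permutes them, and
    doubling the first half of level n + 1 gives level n. *)
Definition odd_angle {R : realType} (n k : nat) : R :=
  (k.*2.+1)%:R * pi / 2 ^+ n.+2.

Lemma odd_angle_itv {R : realType} n k : (k < 2 ^ n)%N ->
  0 < @odd_angle R n k < pi / 2.
Proof.
move=> kn; have p0 := pi_gt0 R.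
have e0 : 0 < 2 ^+ n.+2 :> R by rewrite exprn_gt0.
apply/andP; split; first by rewrite /odd_angle divr_gt0// mulr_gt0.
rewrite /odd_angle ltr_pdivrMr//.
rewrite mulrC -mulrA ltr_pM2l// exprS mulrA mulVf// mul1r.
by rewrite -natrX ltr_nat expnS; lia.
Qed.

(** Pair x with pi/2 - x at level n + 1: by [inv_sin_sqr_double] each pair is four times the term at
    2x, a term of level n. Level 0 is the single angle pi/4. *)
Lemma sum_inv_sin_sqr {R : realType} n :
  \sum_(k < 2 ^ n) (sin (odd_angle n k))^-2 = 2 * 4 ^+ n :> R.
Proof.
elim: n => [|n IH].
  rewrite expn0 big_ord1 /odd_angle expr0 !mulr1 mul1r.
  have := @inv_sin_sqr_double R (pi / 4); have p0 := pi_gt0 R.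
  rewrite (_ : pi / 2 - pi / 4 = pi / 4); last by field.
  rewrite (_ : 2 * (pi / 4) = pi / 2); last by field.
  rewrite sin_pihalf expr1n invr1 (_ : 2 ^+ 2 = 4); last by ring.
  by lra.
rewrite expnS (big_ord_pairs (fun k => (sin (odd_angle n.+1 k))^-2)).
rewrite exprS mulrCA -IH mulr_sumr; apply: eq_bigr => k _.
rewrite (_ : odd_angle n k = 2 * odd_angle n.+1 k); last first.
  by rewrite /odd_angle [in RHS]exprS; field; rewrite expf_neq0.
have kn := ltn_ord k.
rewrite -inv_sin_sqr_double; last first.
  by apply: odd_angle_itv; rewrite expnS; lia.
congr (_ + (sin _)^-2); apply/eqP; rewrite eq_sym subr_eq; apply/eqP.
rewrite /odd_angle -!mulrDl -natrD.
rewrite (_ : (_ + _)%N = (2 * 2 ^ n * 2)%N); last by lia.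
by rewrite !natrM natrX !exprS; field; rewrite expf_neq0.
Qed.

(** Bounding each term of [sum_inv_sin_sqr] by x^-2 + 1 costs 2^n in all, which is small against the
    total of order 4^n. *)
Lemma sum_inv_odd_sqr_ge {R : realType} n :
  pi ^+ 2 / 8 - pi ^+ 2 / 16 / 2 ^+ n <=
    \sum_(k < 2 ^ n) (k.*2.+1)%:R^-2 :> R.
Proof.
have p0 := pi_gt0 R; set S := \sum_(k < _) _.
have e0 : 0 < 2 ^+ n :> R by rewrite exprn_gt0.
have : 2 * 4 ^+ n <= 16 * 4 ^+ n / pi ^+ 2 * S + 2 ^+ n.
  have -> : 2 ^+ n = \sum_(k < 2 ^ n) 1 :> R.
    by rewrite sumr_const card_ord natrX.
  rewrite -sum_inv_sin_sqr mulr_sumr.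
  rewrite -big_split/= ler_sum// => k _.
  apply: le_trans (inv_sin_sqr_le (odd_angle_itv (ltn_ord k))) _.
  rewrite lerD2r /odd_angle (_ : 4 = 2 ^+ 2); last by rewrite expr2; lra.
  rewrite -exprM mulnC exprM !exprSr expr0 !mul1r le_eqVlt.
  apply/orP; left; apply/eqP.
  have k0 : 0 < k.*2.+1%:R :> R by rewrite ltr0n.
  move: (k.*2.+1%:R) (pi : R) (2 ^+ n) k0 p0 e0 => a b c a0 b0 c0.
  by field; rewrite !gt_eqF.
rewrite (_ : 4 ^+ n = 2 ^+ n * 2 ^+ n); last first.
  by rewrite -exprMn; congr (_ ^+ _); lra.
move: (2 ^+ n) (pi : R) e0 p0 => e P e0 p0 H.
rewrite -(@ler_pM2l _ (16 * (e * e) / P ^+ 2)); last first.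
  by rewrite divr_gt0 ?exprn_gt0// !mulr_gt0.
rewrite -(lerD2r e); apply: le_trans H; rewrite le_eqVlt; apply/orP; left.
by apply/eqP; field; rewrite !gt_eqF.
Qed.

Definition inv_sqr_sum {R : realType} (K : nat) : R :=
  \sum_(k < K) k.+1%:R^-2.

Lemma inv_sqr_sumS {R : realType} K :
  inv_sqr_sum K.+1 = inv_sqr_sum K + K.+1%:R^-2 :> R.
Proof. exact: big_ord_recr. Qed.

(** Telescoping with 1/M - 1/(M + 1) >= 1/(M + 1)^2; this bounds the tail of zeta(2) beyond K by
    1/K. *)
Lemma inv_sqr_sum_addV {R : realType} K M : (0 < K)%N -> (K <= M)%N ->
  inv_sqr_sum M + M%:R^-1 <= inv_sqr_sum K + K%:R^-1 :> R.
Proof.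
move=> K0; elim: M => [|M IH]; first by rewrite leqNgt K0.
rewrite leq_eqVlt => /predU1P[<-//|]; rewrite ltnS => KM.
apply: le_trans (IH KM); rewrite inv_sqr_sumS -addrA lerD2l.
have M0 : 0 < M%:R :> R by rewrite ltr0n; lia.
rewrite -natr1; move: (M%:R) M0 => m m0.
have m10 : 0 < m + 1 by lra.
rewrite -subr_ge0 (_ : _ - _ = m^-1 * (m + 1)^-2).
  by rewrite mulr_ge0// invr_ge0 ?exprn_ge0 ?(ltW m0) ?(ltW m10).
by field; rewrite !gt_eqF.
Qed.

Lemma inv_sqr_sum_double {R : realType} M : inv_sqr_sum (2 * M) =
  \sum_(k < M) (k.*2.+1)%:R^-2 + inv_sqr_sum M / 4 :> R.
Proof.
elim: M => [|M IH]; first by rewrite /inv_sqr_sum !big_ord0 mul0r addr0.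
rewrite mulnS add2n 2!inv_sqr_sumS IH inv_sqr_sumS big_ord_recr/= mulrDl.
rewrite -mul2n (_ : (2 * M).+2 = 2 * M.+1)%N; last by lia.
have -> : (2 * M.+1)%:R^-2 = M.+1%:R^-2 / 4 :> R.
  by rewrite natrM exprMn invfM mulrC -[2 ^+ 2]natrX.
by ring.
Qed.

Lemma le_inv_sqr_sum {R : realType} : {homo @inv_sqr_sum R : K M / (K <= M)%N >-> K <= M}.
Proof.
apply: homo_leq => [//|? ? ?|K]; first exact: le_trans.
by rewrite inv_sqr_sumS lerDl invr_ge0 exprn_ge0.
Qed.

Lemma le_of_le_add_div {R : realType} (a b c : R) :
  (forall n, (0 < n)%N -> a <= b + c / n%:R) -> a <= b.
Proof.
move=> H; rewrite leNgt; apply/negP => ba.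
pose n := (Num.bound `|c / (a - b)|).+1.
have ab0 : 0 < a - b by rewrite subr_gt0.
have n0 : 0 < n%:R :> R by rewrite ltr0n.
have : c / (a - b) < n%:R.
  apply: le_lt_trans (ler_norm _) (lt_trans (archi_boundP (normr_ge0 _)) _).
  by rewrite ltr_nat.
rewrite ltr_pdivrMr// mulrC; have := H n isT.
by rewrite -lerBlDl ler_pdivlMr//; lra.
Qed.

(** [z] is zeta(2), obtained as a supremum. The first two clauses bracket it by partial sums, since
    the inductions on p(n) only see finite sums. *)
Lemma exists_zeta2 {R : realType} : exists z : R,
  [/\ forall K, inv_sqr_sum K <= z,
      forall K, (0 < K)%N -> z <= inv_sqr_sum K + K%:R^-1 &
      pi ^+ 2 / 6 <= z].
Proof.
pose E := range (@inv_sqr_sum R).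
have E0 : E !=set0 by exists (inv_sqr_sum 0), 0%N.
have leE K M : (0 < K)%N -> inv_sqr_sum M <= inv_sqr_sum K + K%:R^-1 :> R.
  move=> K0; have [KM|/ltnW MK] := leqP K M.
    by apply: le_trans (inv_sqr_sum_addV K0 KM); rewrite lerDl invr_ge0.
  by apply: le_trans (le_inv_sqr_sum MK) _; rewrite lerDl invr_ge0.
have supE : has_sup E.
  split=> //; exists (inv_sqr_sum 1 + 1%:R^-1) => _ [M _ <-]; exact: leE.
have zE K : inv_sqr_sum K <= sup E.
  by apply: sup_upper_bound => //; exists K.
exists (sup E); split=> //.
  by move=> K K0; apply: ge_sup => // _ [M _ <-]; exact: leE.
(* Splitting into odd and even integers gives (3/4) z >= pi^2/8 - (pi^2/16 + 1/4) / 2^n, and 1/2^n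
   <= 1/n. *)
apply: (@le_of_le_add_div _ _ _ ((pi ^+ 2 / 16 + 1 / 4) / 3 * 4)) => n n0.
have n2 : (0 < 2 ^ n)%N by rewrite expn_gt0.
have := zE (2 * 2 ^ n)%N; have : sup E <= inv_sqr_sum (2 ^ n) + (2 ^ n)%:R^-1.
  by apply: ge_sup => // _ [M _ <-]; exact: leE.
rewrite inv_sqr_sum_double; have := @sum_inv_odd_sqr_ge R n.
have : (2 ^ n)%:R^-1 <= n%:R^-1 :> R.
  by rewrite lef_pV2 ?posrE ?ltr0n// ler_nat ltnW// ltn_expl.
rewrite natrX => Hn; have : pi ^+ 2 / 16 / 2 ^+ n <= pi ^+ 2 / 16 / n%:R :> R.
  by rewrite ler_wpM2l// divr_ge0// exprn_ge0// pi_ge0.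
lra.
Qed.

(** * Moments of the exponential *)

(* This is y / 2 <= sinh (y / 2). *)
Lemma sqr_mul_expRN_le {R : realType} (y : R) : 0 <= y ->
  y ^+ 2 * expR (- y) <= (1 - expR (- y)) ^+ 2.
Proof.
move=> y0; pose t := y / 2; have t0 : 0 <= t by rewrite divr_ge0.
pose f : R -> R := expR * (expR - (id + id)).
have : f 0 <= f t.
  apply: (le_of_derive_ge0 (df := fun t => 2 * expR t * (expR t - 1 - t)) t0).
    by move=> u; apply: is_derive_eq; rewrite /GRing.scale/= ?fctE; ring.
  move=> u _; rewrite !mulr_ge0 ?expR_ge0//.
  by rewrite -addrA -opprD subr_ge0 expR_ge1Dx.
rewrite /f !fctE expR0 addr0 subr0 mulr1 => H.
have e0 := expR_gt0 t; have et : expR (- y) = (expR t)^-2.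
  by rewrite expRN /t -expRM_natr divfK.
rewrite et (_ : y = 2 * t); last by rewrite /t mulrC divfK.
have -> : (2 * t) ^+ 2 * (expR t)^-2 = (2 * t * expR t / expR t ^+ 2) ^+ 2.
  by field; rewrite gt_eqF.
rewrite ler_sqr ?nnegrE; last 2 first.
- by rewrite divr_ge0 ?mulr_ge0// ?exprn_ge0// ?(ltW e0).
- by rewrite -et subr_ge0 expR_le1 oppr_le0.
rewrite ler_pdivrMr ?exprn_gt0// mulrBl mul1r mulVf ?expf_neq0 ?gt_eqF//.
by rewrite expr2; lra.
Qed.

(* This is tanh (y / 2) <= y / 2. *)
Lemma oneBexpRN_le {R : realType} (y : R) : 0 <= y ->
  1 - expR (- y) <= y / 2 * (1 + expR (- y)).
Proof.
move=> y0; pose f : R -> R := id * expR + id - (expR + expR).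
have : f 0 <= f y.
  apply: (le_of_derive_ge0 (df := fun t => t * expR t + 1 - expR t) y0).
    by move=> u; apply: is_derive_eq; rewrite /GRing.scale/= ?fctE; ring.
  move=> u _; have := expR_ge1Dx (- u); have := expR_gt0 u.
  by rewrite -(ler_pM2l (expR_gt0 u)) expRN mulfV ?gt_eqF ?expR_gt0//; lra.
rewrite /f !fctE expR0 expRN => H; have e0 := expR_gt0 y.
rewrite -(ler_pM2r e0) mulrBl mul1r mulVf ?gt_eqF//.
have -> : y / 2 * (1 + (expR y)^-1) * expR y = y / 2 * (expR y + 1).
  by field; rewrite gt_eqF.
by lra.
Qed.

(** For i = 1 the full series is q / (1 - q)^2 = 1 / (4 sinh^2 (y/2)) with q = e^-y, whence the two
    hyperbolic inequalities above. Truncating at V keeps all sums finite. *)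
Definition exp_moment {R : realType} (i V : nat) (y : R) : R :=
  \sum_(v < V) v.+1%:R ^+ i * expR (- (y * v.+1%:R)).

Lemma exp_moment1_eq {R : realType} V (y : R) (q := expR (- y)) :
  (1 - q) ^+ 2 * exp_moment 1 V y =
    q * (1 - V.+1%:R * q ^+ V + V%:R * q ^+ V.+1).
Proof.
have qE v : expR (- (y * v%:R)) = q ^+ v by rewrite -mulNr expRM_natr.
elim: V => [|V IH].
  by rewrite /exp_moment big_ord0 expr0 mul0r !mulr0 mulr1 subrr addr0 mulr0.
rewrite /exp_moment big_ord_recr/= mulrDr -[\sum_(_ < _) _]/(exp_moment 1 V y).
by rewrite IH qE expr1 !exprS -!natr1; ring.
Qed.

Lemma exp_moment1_le {R : realType} V (y : R) : 0 < y ->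
  exp_moment 1 V y <= y^-2.
Proof.
move=> y0; have := exp_moment1_eq V y; have := sqr_mul_expRN_le (ltW y0).
have : expR (- y) < 1 by rewrite expR_lt1 oppr_lt0.
have := expR_gt0 (- y); move: (expR _) (exp_moment _ _ _) => q G q0 q1 yq GE.
have q10 : 0 < (1 - q) ^+ 2 by rewrite exprn_gt0// subr_gt0.
rewrite -(ler_pM2l q10) GE; apply: (@le_trans _ _ q); last first.
  by rewrite ler_pdivlMr ?exprn_gt0// mulrC.
rewrite ger_pMr// -addrA gerDl addrC subr_le0.
rewrite exprS mulrA ler_wpM2r ?exprn_ge0 ?(ltW q0)// -natr1.
by have : 0 <= V%:R :> R by []; nra.
Qed.

(** The loss 1/4 comes from coth^2 = 1 + 1/sinh^2 and tanh (y/2) <= y/2; the last subtracted term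
    bounds what the truncation at V removes. *)
Lemma exp_moment1_ge {R : realType} V (y : R) : 0 < y ->
  y^-2 - 4^-1 - V.+1%:R * expR (- (y * V%:R)) * y^-2 <= exp_moment 1 V y.
Proof.
move=> y0; have := exp_moment1_eq V y; have := sqr_mul_expRN_le (ltW y0).
have -> : expR (- (y * V%:R)) = expR (- y) ^+ V by rewrite -mulNr expRM_natr.
have := oneBexpRN_le (ltW y0).
have : expR (- y) < 1 by rewrite expR_lt1 oppr_lt0.
have := expR_gt0 (- y).
move: (expR _) (exp_moment _ _ _) => q G q0 q1 yq1 yq GE.
have q10 : 0 < (1 - q) ^+ 2 by rewrite exprn_gt0// subr_gt0.
have y20 : 0 < y ^+ 2 by rewrite exprn_gt0.
have q1' : 0 < 1 - q by rewrite subr_gt0.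
have yq2 : y^-2 - 4^-1 <= q / (1 - q) ^+ 2.
  rewrite lerBlDr -(@ler_pM2l _ (y ^+ 2 * (1 - q) ^+ 2)) ?mulr_gt0//.
  have -> : y ^+ 2 * (1 - q) ^+ 2 / y ^+ 2 = (1 - q) ^+ 2.
    by field; rewrite gt_eqF.
  have -> : y ^+ 2 * (1 - q) ^+ 2 * (q / (1 - q) ^+ 2 + 4^-1) =
            (y / 2 * (1 + q)) ^+ 2.
    by field; rewrite gt_eqF.
  by rewrite ler_sqr ?nnegrE ?subr_ge0 ?(ltW q1)// (le_trans _ yq1)// subr_ge0 ltW.
have yq3 : q / (1 - q) ^+ 2 <= y^-2.
  by rewrite ler_pdivrMr// ler_pdivlMl.
have -> : G = q / (1 - q) ^+ 2 * (1 - V.+1%:R * q ^+ V + V%:R * q ^+ V.+1).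
  apply: (mulfI (x := (1 - q) ^+ 2)); first by rewrite gt_eqF.
  by rewrite GE; field; rewrite gt_eqF.
have q20 : 0 <= q / (1 - q) ^+ 2 by rewrite divr_ge0 ?(ltW q0) ?(ltW q10).
rewrite mulrDr mulrBr mulr1 -[leLHS]addr0; apply: lerD.
  by rewrite lerB// mulrC ler_wpM2l// mulr_ge0// exprn_ge0 ?ltW.
by rewrite mulr_ge0// mulr_ge0// exprn_ge0 ?ltW.
Qed.

Lemma sqr_mul_expRN_le4 {R : realType} (t : R) : 0 <= t ->
  t ^+ 2 * expR (- t) <= 4.
Proof.
move=> t0; rewrite expRN ler_pdivrMr ?expR_gt0//.
have -> : expR t = expR (t / 2) ^+ 2 by rewrite -expRM_natr divfK.
have := expR_ge1Dx (t / 2); move: (expR _) => e he.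
have : (t / 2) ^+ 2 <= e ^+ 2.
  by rewrite ler_sqr ?nnegrE ?divr_ge0//; lra.
by rewrite !expr2; lra.
Qed.

(** Half of the exponential absorbs v^2, through t^2 e^-t <= 4 at t = y v / 2; the other half leaves
    the first moment at y / 2. *)
Lemma exp_moment3_le {R : realType} V (y : R) : 0 < y ->
  exp_moment 3 V y <= 64 * y^-4.
Proof.
move=> y0; have y20 : 0 < y / 2 by rewrite divr_gt0.
have y0' : y != 0 by rewrite gt_eqF.
apply: (@le_trans _ _ (16 / y ^+ 2 * exp_moment 1 V (y / 2))).
  rewrite mulr_sumr ler_sum// => v _; set w := v.+1%:R.
  have w0 : 0 <= w by [].
  have := @sqr_mul_expRN_le4 _ (y / 2 * w); rewrite mulr_ge0 ?(ltW y20)// => /(_ isT).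
  have -> : expR (- (y * w)) = expR (- (y / 2 * w)) ^+ 2.
    by rewrite -expRM_natr; congr expR; field.
  have := expR_ge0 (- (y / 2 * w)); move: (expR _) => e e0 H.
  rewrite (_ : _ * _ = ((y / 2 * w) ^+ 2 * e) * (4 * w * e / y ^+ 2)); last by field.
  rewrite (_ : 16 / _ * _ = 4 * (4 * w * e / y ^+ 2)); last by field.
  rewrite ler_wpM2r// divr_ge0 ?exprn_ge0 ?(ltW y0)//.
  by rewrite mulr_ge0// mulr_ge0.
have -> : 64 * y^-4 = 16 / y ^+ 2 * (y / 2)^-2 by field.
by rewrite ler_wpM2l ?exp_moment1_le// divr_ge0// exprn_ge0// ltW.
Qed.

(** * Square-root estimates and the lower estimate of Erdos' sum *)

Lemma sqrt_sub_le {R : realType} (n x : nat) : (0 < n)%N -> (x <= n)%N ->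
  Num.sqrt (n - x)%:R <= Num.sqrt n%:R - x%:R / (2 * Num.sqrt n%:R) :> R.
Proof.
move=> n0 xn; have r0 : 0 < Num.sqrt n%:R :> R by rewrite sqrtr_gt0 ltr0n.
have r2 := sqr_sqrtr (ler0n R n); have m2 := sqr_sqrtr (ler0n R (n - x)).
have m0 := sqrtr_ge0 ((n - x)%:R : R).
move: r0 r2 m0 m2; rewrite natrB//.
move: (Num.sqrt _) (Num.sqrt _) => m r r0 r2 m0 m2.
rewrite -(ler_pM2l (_ : 0 < 2 * r)) ?mulr_gt0// mulrBr.
rewrite mulrCA mulfV ?mulr1; last by rewrite gt_eqF// mulr_gt0.
have : 0 <= (r - m) ^+ 2 by rewrite sqr_ge0.
by move: r2 m2; rewrite sqrrB; nra.
Qed.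

(** After division by sqrt n, and with a = sqrt (1 - u), the two sides differ by a (a - 1)^2 (a + 2)
    / 2. The coefficient 1/2 of u^2, instead of Taylor's 1/8, makes the bound hold up to u = 1. *)
Lemma sqrt_sub_ge {R : realType} (n x : nat) : (0 < n)%N -> (x <= n)%N ->
  Num.sqrt n%:R * (1 - x%:R / n%:R / 2 - (x%:R / n%:R) ^+ 2 / 2)
    <= Num.sqrt (n - x)%:R :> R.
Proof.
move=> n0 xn; have r0 : 0 < Num.sqrt n%:R :> R by rewrite sqrtr_gt0 ltr0n.
have nN0 : n%:R != 0 :> R by rewrite pnatr_eq0 -lt0n.
set u := x%:R / n%:R; have xE : x%:R = n%:R * u by rewrite mulrC divfK.
have u0 : 0 <= u by rewrite divr_ge0.
have u1 : u <= 1 by rewrite ler_pdivrMr ?ltr0n// mul1r ler_nat.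
rewrite natrB// xE -{2}[n%:R]mulr1 -mulrBr sqrtrM// ler_pM2l//.
have a2 : Num.sqrt (1 - u) ^+ 2 = 1 - u by rewrite sqr_sqrtr// subr_ge0.
have := sqrtr_ge0 (1 - u); move: (Num.sqrt _) a2 => a a2 a0.
have -> : u = 1 - a ^+ 2 by rewrite a2; ring.
rewrite -subr_ge0 (_ : _ - _ = a * ((a - 1) ^+ 2 * (a + 2)) / 2).
  by rewrite divr_ge0// mulr_ge0// mulr_ge0 ?sqr_ge0// addr_ge0.
by field.
Qed.

Lemma sum_sqr_ge {R : realType} K : K%:R ^+ 3 / 3 <= \sum_(v < K) v.+1%:R ^+ 2 :> R.
Proof.
elim: K => [|K IH]; first by rewrite big_ord0 exprS mul0r mul0r.
rewrite big_ord_recr/=; have : 0 <= K%:R :> R by [].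
move: IH; rewrite -[K.+1%:R]natr1; move: (K%:R) (\sum_(_ < _) _) => a S.
rewrite -subr_ge0 => HS a0; rewrite -subr_ge0; apply: le_trans HS _; rewrite -subr_ge0.
rewrite (_ : _ - _ = a + 2 / 3); last by field.
by rewrite addr_ge0.
Qed.

(** K / 4 collects the constant losses of [exp_moment1_ge], 1 / K is the tail of zeta(2), and the
    truncation factor is largest at k = 0. *)
Lemma sum_exp_moment1_ge {R : realType} (z s : R) K V : 0 < s -> 0 < z ->
  inv_sqr_sum K <= z -> z <= inv_sqr_sum K + K%:R^-1 ->
  (z - K%:R^-1) / s ^+ 2 - K%:R / 4 - V.+1%:R * expR (- (s * V%:R)) * z / s ^+ 2
    <= \sum_(k < K) exp_moment 1 V (s * k.+1%:R).
Proof.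
move=> s0 z0 leHz lezH; set E := V.+1%:R * expR _.
have E0 : 0 <= E by rewrite mulr_ge0// expR_ge0.
apply: (@le_trans _ _ ((1 - E) / s ^+ 2 * inv_sqr_sum K - K%:R / 4)).
  have -> : (1 - E) / s ^+ 2 * inv_sqr_sum K - K%:R / 4 =
     inv_sqr_sum K / s ^+ 2 - K%:R / 4 - E * inv_sqr_sum K / s ^+ 2.
    by field; rewrite gt_eqF.
  rewrite lerB//; last by rewrite ler_wpM2r ?invr_ge0 ?exprn_ge0 ?(ltW s0)// ler_wpM2l.
  by rewrite lerD2r ler_wpM2r ?invr_ge0 ?exprn_ge0 ?(ltW s0)// lerBlDr.
have -> : K%:R / 4 = \sum_(k < K) 4^-1 :> R.
  by rewrite sumr_const card_ord mulr_natl.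
rewrite mulr_sumr -sumrB ler_sum// => k _.
have y0 : 0 < s * k.+1%:R by rewrite mulr_gt0.
apply: le_trans (exp_moment1_ge V y0).
have : expR (- (s * k.+1%:R * V%:R)) <= expR (- (s * V%:R)).
  rewrite ler_expR lerN2 ler_wpM2r// ler_peMr ?(ltW s0)//.
  by rewrite (_ : 1 = 1%:R)// ler_nat.
set e := expR _ => eE.
have : V.+1%:R * e <= E by rewrite ler_wpM2l.
move: (_ * e) => F FE.
have -> : (1 - E) / s ^+ 2 / k.+1%:R ^+ 2 = (s * k.+1%:R)^-2 - E * (s * k.+1%:R)^-2.
  have k0 : k.+1%:R != 0 :> R by rewrite pnatr_eq0.
  by move: (k.+1%:R) k0 => a a0; field; rewrite a0 gt_eqF.
have i0 : 0 <= (s * k.+1%:R)^-2 by rewrite invr_ge0 exprn_ge0// ltW.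
by have := ler_wpM2r i0 FE; move: (_^-2) => i; lra.
Qed.

Lemma exp_moment2_ge {R : realType} (s : R) K V : 0 < s -> (K <= V)%N ->
  expR (- (s * K%:R)) * (K%:R ^+ 3 / 3) <= exp_moment 2 V s.
Proof.
move=> s0 KV; rewrite /exp_moment.
rewrite -(big_mkord xpredT (fun v => v.+1%:R ^+ 2 * expR (- (s * v.+1%:R)))).
rewrite (@big_cat_nat _ _ _ K)//= -[leLHS]addr0; apply: lerD; last first.
  by apply: sumr_ge0 => v _; rewrite mulr_ge0 ?exprn_ge0 ?expR_ge0.
rewrite big_mkord; apply: le_trans (ler_wpM2l (expR_ge0 _) (sum_sqr_ge K)) _.
rewrite mulr_sumr ler_sum// => v _; rewrite mulrC ler_wpM2l ?exprn_ge0//.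
by rewrite ler_expR lerN2 ler_wpM2l ?(ltW s0)// ler_nat.
Qed.

Lemma sum_exp_moment3_le {R : realType} (z s : R) K V : 0 < s ->
  inv_sqr_sum K <= z ->
  \sum_(k < K) k.+1%:R ^+ 2 * exp_moment 3 V (s * k.+1%:R) <= 64 * z / s ^+ 4.
Proof.
move=> s0 leHz; apply: (@le_trans _ _ (64 / s ^+ 4 * inv_sqr_sum K)).
  rewrite mulr_sumr ler_sum// => k _.
  have k0 : 0 < k.+1%:R :> R by rewrite ltr0n.
  have := exp_moment3_le V (mulr_gt0 s0 k0); move: (exp_moment _ _ _) => M.
  move: (k.+1%:R) k0 => a a0 HM.
  apply: le_trans (ler_wpM2l (exprn_ge0 2 (ltW a0)) HM) _.
  by rewrite le_eqVlt; apply/orP; left; apply/eqP; field; rewrite !gt_eqF.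
rewrite mulrAC ler_wpM2r ?invr_ge0 ?exprn_ge0 ?(ltW s0)//.
by rewrite ler_wpM2l.
Qed.

Lemma exp_moment_ge0 {R : realType} i V (y : R) : 0 <= exp_moment i V y.
Proof.
by apply: sumr_ge0 => v _; rewrite mulr_ge0 ?exprn_ge0 ?expR_ge0.
Qed.

Lemma weighted_sum_split {R : realType} (s a b : R) K V :
  \sum_(k < K) \sum_(v < V) v.+1%:R *
      (expR (- (s * (k.+1 * v.+1)%:R)) *
       (1 + a * (k.+1 * v.+1)%:R - b * (k.+1 * v.+1)%:R ^+ 2)) =
  \sum_(k < K) exp_moment 1 V (s * k.+1%:R) +
  a * \sum_(k < K) k.+1%:R * exp_moment 2 V (s * k.+1%:R) -
  b * \sum_(k < K) k.+1%:R ^+ 2 * exp_moment 3 V (s * k.+1%:R).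
Proof.
rewrite !mulr_sumr -big_split -sumrB; apply: eq_bigr => k _ /=.
rewrite !mulr_sumr -big_split -sumrB; apply: eq_bigr => v _ /=.
by rewrite natrM [s * (_ * _)]mulrA; move: (expR _) => e; ring.
Qed.

(** With s = w / sqrt n the main term is z / s^2 = n. The term with B contributes order B sqrt n,
    since the second moment at s is of order s^-3, and every loss is O(sqrt n) with a constant free
    of B. Taking K = floor(sqrt n) balances the losses K / 4 and n / (z K), and V = n^2 makes the
    truncation harmless. *)
Lemma erdos_sum_ge {R : realType} (z w : R) : 0 < w -> w ^+ 2 = z ->
  (forall K, inv_sqr_sum K <= z) ->
  (forall K, (0 < K)%N -> z <= inv_sqr_sum K + K%:R^-1) ->
  exists B : nat, forall n, (0 < n)%N -> exists2 K, (K <= n)%N &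
    n%:R <= \sum_(k < K) \sum_(v < n ^ 2) v.+1%:R *
      (expR (- (w / Num.sqrt n%:R * (k.+1 * v.+1)%:R)) *
       (1 + B%:R / n%:R * (k.+1 * v.+1)%:R -
         w * Num.sqrt n%:R / n%:R ^+ 2 * (k.+1 * v.+1)%:R ^+ 2)).
Proof.
move=> w0 wz leHz lezH; have z0 : 0 < z by rewrite -wz exprn_gt0.
(* 10 / z and 4^-1 are the losses in [T1], 64 / w is the one in [T3], and 24 e^w inverts the lower
   bound on [T2]. *)
pose C := (10 / z + 4^-1 + 64 / w) * 24 * expR w.
pose B := (Num.bound `|C|).+1; exists B => n n0.
have BC : C <= B%:R.
  apply: le_trans (ler_norm _) (le_trans (ltW (archi_boundP (normr_ge0 _))) _).
  by rewrite ler_nat.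
set r := Num.sqrt n%:R; set s := w / r.
have r1 : 1 <= r by rewrite -sqrtr1 ler_wsqrtr// ler1n.
have r0 : 0 < r by lra.
have rn : n%:R = r ^+ 2 by rewrite sqr_sqrtr.
have s0 : 0 < s by rewrite divr_gt0.
have /andP[Kr rK] : (Num.truncn r)%:R <= r < (Num.truncn r).+1%:R.
  exact/truncn_itv/ltW.
set K := Num.truncn r in Kr rK; exists K.
  rewrite -(ler_nat R) rn; apply: le_trans Kr _.
  by rewrite expr2 ler_peMr// ltW.
have K0 : (0 < K)%N by rewrite truncn_gt0.
have K1 : 1 <= K%:R :> R by rewrite ler1n.
have rK2 : r <= 2 * K%:R by move: rK; rewrite -natr1; lra.
rewrite weighted_sum_split; set T1 := \sum_(k < K) exp_moment _ _ _.
set T2 := \sum_(_ < _) _; set T3 := \sum_(_ < _) _.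
have hT1 : r ^+ 2 - (10 / z + 4^-1) * r <= T1.
  apply: le_trans (sum_exp_moment1_ge (n ^ 2) s0 z0 (leHz K) (lezH K K0)).
  have -> : (z - K%:R^-1) / s ^+ 2 = r ^+ 2 - r ^+ 2 / K%:R / z.
    by rewrite /s -wz; field; rewrite !gt_eqF//; lra.
  have : r ^+ 2 / K%:R / z <= 2 / z * r.
    have -> : 2 / z * r = 2 * r / z by ring.
    rewrite ler_wpM2r ?invr_ge0 ?(ltW z0)//.
    by rewrite ler_pdivrMr ?ltr0n// expr2 mulrAC ler_wpM2r// ltW.
  have : (n ^ 2).+1%:R * expR (- (s * (n ^ 2)%:R)) * z / s ^+ 2 <= 8 / z * r.
    have e4 : 1 <= r ^+ 4 by rewrite exprn_ege1.
    have := @sqr_mul_expRN_le4 _ (s * (n ^ 2)%:R).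
    rewrite mulr_ge0 ?(ltW s0)// => /(_ isT).
    rewrite -[(n ^ 2).+1%:R]natr1 natrX rn -!exprM.
    move: (expR _) (expR_ge0 (- (s * r ^+ (2 * 2)))) => e e0 He.
    have HE : s * r ^+ (2 * 2) = w * r ^+ 3 by rewrite /s; field; rewrite gt_eqF.
    move: He; rewrite HE => H; apply: (@le_trans _ _ (2 * r ^+ 4 * e * z / s ^+ 2)).
            rewrite !ler_wpM2r ?invr_ge0 ?exprn_ge0 ?(ltW s0) ?(ltW z0)//.
      by rewrite (_ : (2 * 2 = 4)%N)//; lra.
    have -> : 2 * r ^+ 4 * e * z / s ^+ 2 = 2 / z * ((w * r ^+ 3) ^+ 2 * e).
      by rewrite /s -wz; field; rewrite !gt_eqF.
    have -> : 8 / z * r = 2 / z * (4 * r) by field; rewrite gt_eqF.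
    by rewrite ler_wpM2l ?divr_ge0 ?(ltW z0)//; lra.
  by lra.
have hT2 : expR (- w) / 24 * r ^+ 3 <= T2.
  rewrite /T2; case: K K0 K1 rK2 Kr {rK T1 hT1 T2 T3} => // K' _ K1 rK2 Kr.
  (* The term k = 0 alone already has order r^3. *)
  rewrite big_ord_recl/= mul1r mulr1 -[leLHS]addr0; apply: lerD; last first.
    by apply: sumr_ge0 => k _; rewrite mulr_ge0// exp_moment_ge0.
  have KV : (K'.+1 <= n ^ 2)%N.
    rewrite -(ler_nat R) natrX rn; apply: le_trans Kr _.
    by rewrite -exprM ler_eXnr.
  apply: le_trans (exp_moment2_ge s0 KV); rewrite -mulrA.
  apply: ler_pM; rewrite ?expR_ge0 ?mulr_ge0 ?exprn_ge0 ?(ltW r0)//.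
    rewrite ler_expR lerN2 /s mulrAC ler_pdivrMr// ler_wpM2l// ltW//.
  have : r ^+ 3 <= (2 * K'.+1%:R) ^+ 3 by rewrite lerXn2r ?nnegrE ?mulr_ge0// ltW.
  by rewrite exprMn (_ : 2 ^+ 3 = 8 :> R); [lra|rewrite -natrX].
have hT3 : T3 <= 64 * z / s ^+ 4 by exact: sum_exp_moment3_le.
have hB : r * (10 / z + 4^-1 + 64 / w) <= B%:R / n%:R * (expR (- w) / 24 * r ^+ 3).
  have -> : B%:R / n%:R * (expR (- w) / 24 * r ^+ 3) = r * (B%:R / 24 / expR w).
    by rewrite rn expRN; field; rewrite !gt_eqF// expR_gt0.
  rewrite ler_wpM2l ?(ltW r0)// ler_pdivlMr ?expR_gt0// ler_pdivlMr//.
  by rewrite mulrAC.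
have hB2 : B%:R / n%:R * (expR (- w) / 24 * r ^+ 3) <= B%:R / n%:R * T2.
  by rewrite ler_wpM2l// divr_ge0.
have hD : w * r / n%:R ^+ 2 * T3 <= 64 / w * r.
  have -> : 64 / w * r = w * r / n%:R ^+ 2 * (64 * z / s ^+ 4).
    by rewrite rn /s -wz; field; rewrite !gt_eqF.
  by rewrite ler_wpM2l// divr_ge0 ?mulr_ge0 ?exprn_ge0 ?(ltW w0) ?(ltW r0).
rewrite [leLHS]rn; lra.
Qed.

(** * Growth of solutions of Erdos' recurrence *)

Section erdos_recurrence.
Variables (R : realType) (P : nat -> nat).
(** The ranges are free because the filter discards pairs with k v > n; the lower bound takes
    [V = n ^ 2]. *)
Hypothesis P_rec : forall n K V, (n <= K)%N -> (n <= V)%N ->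
  (n * P n = \sum_(k < K) \sum_(v < V | k.+1 * v.+1 <= n)
               v.+1 * P (n - k.+1 * v.+1))%N.
Variables (z w : R).
Hypotheses (w_gt0 : 0 < w) (wz : w ^+ 2 = z).
Hypothesis leHz : forall K, inv_sqr_sum K <= z.

(** By concavity, e^(2w sqrt (n - kv)) <= e^(2w sqrt n) e^(-s k v) with s = w / sqrt n. The first
    moments then add up to at most z / s^2 = n, the factor on the left of the recurrence. *)
Lemma erdos_upper n : P 0 = 1%N -> (P n)%:R <= expR (2 * w * Num.sqrt n%:R).
Proof.
move=> P0; have [m] := ubnP n; elim: m n => // m IH n; rewrite ltnS => nm.
have [->|n0] := posnP n; first by rewrite P0 sqrtr0 mulr0 expR0.
set r := Num.sqrt n%:R.
have r0 : 0 < r by rewrite sqrtr_gt0 ltr0n.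
have rn : n%:R = r ^+ 2 by rewrite sqr_sqrtr.
pose s := w / r; have s0 : 0 < s by rewrite divr_gt0.
have nR0 : 0 < n%:R :> R by rewrite ltr0n.
rewrite -(ler_pM2l nR0) -natrM (P_rec (leqnn n) (leqnn n)) natr_sum.
apply: (@le_trans _ _ (\sum_(k < n) expR (2 * w * r) * exp_moment 1 n (s * k.+1%:R))).
  apply: ler_sum => k _; rewrite natr_sum mulr_sumr big_mkcond.
  apply: ler_sum => v _; case: ifPn => [kvn|_]; last first.
    by rewrite mulr_ge0 ?mulr_ge0 ?expR_ge0.
  rewrite expr1 mulrCA natrM ler_wpM2l// -expRD.
  have x0 : (0 < k.+1 * v.+1)%N by [].
  apply: (le_trans (IH _ _)); first by lia.
  rewrite ler_expR.
  have := @sqrt_sub_le R _ _ n0 kvn; rewrite -/r.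
  have w20 : 0 <= 2 * w by rewrite mulr_ge0// ltW.
  move=> /(ler_wpM2l w20)/le_trans; apply.
  rewrite natrM mulrBr lerD2l lerN2 /s le_eqVlt; apply/orP; left; apply/eqP.
  by field; rewrite gt_eqF.
rewrite -mulr_sumr mulrC ler_wpM2r ?expR_ge0//.
apply: (@le_trans _ _ (s^-2 * inv_sqr_sum n)).
  rewrite mulr_sumr; apply: ler_sum => k _.
  apply: le_trans (exp_moment1_le _ _) _; first by rewrite mulr_gt0.
  by rewrite exprMn invfM.
apply: (@le_trans _ _ (s^-2 * z)).
  by rewrite ler_wpM2l// invr_ge0 exprn_ge0// ltW.
rewrite rn -wz /s le_eqVlt; apply/orP; left; apply/eqP.
by field; rewrite !gt_eqF.
Qed.

Hypothesis lezH : forall K, (0 < K)%N -> z <= inv_sqr_sum K + K%:R^-1.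

(* The weight n^-B e^(2w sqrt n) is a subsolution of the recurrence: the gain
   B u of n^-B absorbs all the terms of order sqrt n lost elsewhere. *)
Lemma subsolution_le (B n x : nat) : (x < n)%N ->
  expR (2 * w * Num.sqrt n%:R) / n%:R ^+ B *
    (expR (- (w / Num.sqrt n%:R * x%:R)) *
      (1 + B%:R * (x%:R / n%:R) - w * Num.sqrt n%:R * (x%:R / n%:R) ^+ 2)) <=
  expR (2 * w * Num.sqrt (n - x)%:R) / (n - x)%:R ^+ B.
Proof.
set u := _ / n%:R => xn; have n0 : (0 < n)%N by apply: leq_ltn_trans xn.
set r := Num.sqrt n%:R.
have r0 : 0 < r by rewrite sqrtr_gt0 ltr0n.
have rn : n%:R = r ^+ 2 by rewrite sqr_sqrtr.
have nR0 : 0 < n%:R :> R by rewrite ltr0n.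
(* This is 1 - u <= e^-u raised to the power -B. *)
have hB : expR (B%:R * u) / n%:R ^+ B <= ((n - x)%:R ^+ B)^-1.
  have m0 : 0 < (n - x)%:R :> R by rewrite ltr0n subn_gt0.
  rewrite expRM_natl -expr_div_n -exprVn lerXn2r ?nnegrE ?invr_ge0//.
  rewrite ler_pdivrMr// ler_pdivlMl//.
  have -> : (n - x)%:R = (1 - u) * n%:R :> R.
    by rewrite natrB ?(ltnW xn)// mulrBl mul1r /u divfK// gt_eqF.
  rewrite mulrAC ger_pMl//.
  have := expR_ge1Dx (- u); rewrite expRN -(ler_pM2r (expR_gt0 u)).
  by rewrite mulVf// gt_eqF// expR_gt0.
have h1 : 1 + B%:R * u - w * r * u ^+ 2 <= expR (B%:R * u - w * r * u ^+ 2).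
  by rewrite -addrA expR_ge1Dx.
apply: le_trans (_ : _ <= expR (2 * w * Num.sqrt (n - x)%:R) *
   (expR (B%:R * u) / n%:R ^+ B)) _; last by rewrite ler_wpM2l// expR_ge0.
rewrite mulrAC mulrA ler_wpM2r ?invr_ge0 ?exprn_ge0//.
rewrite -expRD.
apply: (@le_trans _ _ (expR (2 * w * r) * (expR (- (w / r * x%:R)) *
   expR (B%:R * u - w * r * u ^+ 2)))).
  by rewrite !ler_wpM2l ?expR_ge0.
rewrite -!expRD ler_expR.
have := @sqrt_sub_ge R _ _ n0 (ltnW xn); rewrite -/r -/u.
have w20 : 0 <= 2 * w by rewrite mulr_ge0// ltW.
move=> /(ler_wpM2l w20).
have -> : x%:R = u * n%:R :> R by rewrite /u divfK// gt_eqF.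
rewrite rn => H.
have -> : w / r * (u * r ^+ 2) = w * u * r by field; rewrite gt_eqF.
by lra.
Qed.

Lemma erdos_lower : (forall n, 0 < P n)%N -> exists B, exists2 A : R, 0 < A &
  forall n, (0 < n)%N ->
    A * (expR (2 * w * Num.sqrt n%:R) / n%:R ^+ B) <= (P n)%:R.
Proof.
move=> P_gt0; have [B hB] := erdos_sum_ge w_gt0 wz leHz lezH.
(* From [n0] on, B + 1 <= w sqrt n, so the weight 1 + B u - w r u^2 is nonpositive for u >= 1. Pairs
   with k v >= n, which [subsolution_le] does not cover, thus only lower the left-hand sum. Below
   [n0], the choice of [A] and P n >= 1 suffice. *)
pose n0 := (Num.bound `|((B%:R + 1) / w) ^+ 2|).+1.
exists B, (expR (- (2 * w * Num.sqrt n0%:R))) => [|n]; first exact: expR_gt0.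
set A := expR (- _); have A0 : 0 <= A by rewrite expR_ge0.
have [m] := ubnP n; elim: m n => // m IH n; rewrite ltnS => nm n_gt0.
have nR0 : 0 < n%:R :> R by rewrite ltr0n.
have [nn0|n0n] := ltnP n n0.
  apply: (@le_trans _ _ 1); last by rewrite ler1n.
  rewrite mulrA ler_pdivrMr ?exprn_gt0// mul1r; apply: (@le_trans _ _ 1).
    rewrite /A -expRD expR_le1 addrC subr_le0 ler_wpM2l ?mulr_ge0 ?(ltW w_gt0)//.
    by rewrite ler_wsqrtr// ler_nat ltnW.
  by rewrite exprn_ege1// ler1n.
set r := Num.sqrt n%:R.
have Bwr : B%:R + 1 <= w * r.
  rewrite mulrC -ler_pdivrMr//.
  have q0 : 0 <= (B%:R + 1) / w by rewrite divr_ge0 ?addr_ge0// ltW.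
  rewrite -(ger0_norm q0) -sqrtr_sqr ler_wsqrtr//.
  apply: le_trans (ler_norm _) (le_trans (ltW (archi_boundP (normr_ge0 _))) _).
  by rewrite ler_nat ltnW.
have [K Kn HK] := hB n n_gt0; move: HK; rewrite -/r => HK.
have nV : (n <= n ^ 2)%N by rewrite -{1}[n]expn1 leq_pexp2l.
rewrite -(ler_pM2l nR0) -natrM (P_rec (leqnn n) nV) natr_sum.
pose F (k : nat) : R := (\sum_(v < n ^ 2 | k.+1 * v.+1 <= n)
  v.+1 * P (n - k.+1 * v.+1))%N%:R.
apply: (@le_trans _ _ (\sum_(k < K) F k)); last first.
  rewrite -!(big_mkord xpredT F) (@big_cat_nat _ _ _ K 0 n)//= lerDl.
  by rewrite sumr_ge0 => // k _; rewrite /F.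
set E := expR _ / _.
apply: (@le_trans _ _ (A * E * (\sum_(k < K) \sum_(v < n ^ 2) v.+1%:R *
      (expR (- (w / r * (k.+1 * v.+1)%:R)) *
       (1 + B%:R / n%:R * (k.+1 * v.+1)%:R -
         w * r / n%:R ^+ 2 * (k.+1 * v.+1)%:R ^+ 2))))).
  by rewrite mulrC ler_wpM2l// mulr_ge0// divr_ge0 ?exprn_ge0 ?expR_ge0.
rewrite mulr_sumr; apply: ler_sum => k _; rewrite mulr_sumr /F natr_sum.
rewrite [leRHS]big_mkcond/=; apply: ler_sum => v _; rewrite mulrCA.
have xE : 1 + B%:R / n%:R * (k.+1 * v.+1)%:R -
         w * r / n%:R ^+ 2 * (k.+1 * v.+1)%:R ^+ 2 =
  1 + B%:R * ((k.+1 * v.+1)%:R / n%:R) - w * r * ((k.+1 * v.+1)%:R / n%:R) ^+ 2.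
  by field; rewrite gt_eqF.
have [xn|nx] := ltnP (k.+1 * v.+1) n.
  rewrite (ltnW xn) [(_ * P _)%:R]natrM ler_wpM2l//.
  have := subsolution_le B xn; rewrite -/r -/E -xE => /(ler_wpM2l A0).
  move=> H; rewrite -[A * E * _]mulrA; apply: le_trans H _.
  apply: IH; last by rewrite subn_gt0.
  by have : (0 < k.+1 * v.+1)%N by []; lia.
apply: (@le_trans _ _ 0); last by case: ifP.
rewrite mulr_ge0_le0// mulr_ge0_le0 ?mulr_ge0 ?divr_ge0 ?exprn_ge0 ?expR_ge0//.
rewrite mulr_ge0_le0 ?expR_ge0// xE.
have u1 : 1 <= (k.+1 * v.+1)%:R / n%:R :> R by rewrite ler_pdivlMr// mul1r ler_nat.
move: (_ / n%:R) u1 => u u1.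
have := ler_wpM2r (_ : 0 <= u ^+ 2) Bwr; have : u <= u ^+ 2 by rewrite expr2 ler_peMr//; lra.
have : 0 <= B%:R :> R by [].
rewrite expr2 => B0 uu /(_ _) H.
have {}H := H ltac:(by rewrite mulr_ge0//; lra).
by nra.
Qed.

End erdos_recurrence.

(** * The recurrence for partition numbers *)

Lemma mem_partitions n l :
  (l \in fset_set (partitions_of n)) = is_partition l && (sumn l == n).
Proof.
rewrite in_fset_set; last exact: finite_partitions_of.
apply/idP/andP; rewrite in_setE; first by move=> [lP ->].
by move=> [lP /eqP].
Qed.

Lemma leq_sumn_mem (l : seq nat) x : x \in l -> (x <= sumn l)%N.
Proof.
elim: l => //= y l IH; rewrite inE => /predU1P[->|/IH]; first exact: leq_addr.
by move=> /leq_trans; apply; exact: leq_addl.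
Qed.

Lemma leq_size_sumn (l : seq nat) : 0%N \notin l -> (size l <= sumn l)%N.
Proof. by elim: l => //= -[|y] l IH //; rewrite inE /= => /IH; lia. Qed.

Lemma sum_ord_ltn m K : (\sum_(k < K) (k < m) = minn m K)%N.
Proof.
elim: K => [|K IH]; first by rewrite big_ord0 minn0.
by rewrite big_ord_recr/= IH; case: ltnP; lia.
Qed.

(** Each multiplicity is written as the number of k >= 1 such that the part occurs at least k times.
    Summed over the partitions of n, each pair (k, v) becomes a count given by
    [partition_number_add_parts]. *)
Lemma sumn_count (l : seq nat) K V : 0%N \notin l -> (sumn l <= K)%N ->
  (sumn l <= V)%N ->
  (sumn l = \sum_(k < K) \sum_(v < V) v.+1 * (k < count_mem v.+1 l))%N.
Proof.
move=> l0 lK lV; rewrite exchange_big/=.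
transitivity (\sum_(v < V) v.+1 * count_mem v.+1 l)%N; last first.
  apply: eq_bigr => v _; rewrite -big_distrr/= sum_ord_ltn (minn_idPl _)//.
  by apply: leq_trans (count_size _ _) (leq_trans (leq_size_sumn l0) lK).
elim: l l0 lV {lK} => [|x l IH] /=.
  by rewrite big1 // => v _; rewrite muln0.
rewrite inE negb_or => /andP[x0 l0] lV.
rewrite IH//; last by lia.
have {}x0 : (0 < x)%N by rewrite lt0n eq_sym.
have xV : (x.-1 < V)%N by lia.
under [RHS]eq_bigr do rewrite mulnDr.
rewrite [RHS]big_split [X in _ = (X + _)%N](bigD1 (Ordinal xV))//=.
rewrite prednK// eqxx muln1.
rewrite [X in (_ + X + _)%N]big1 ?addn0// => v vx; rewrite -(inj_eq val_inj) /= in vx.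
by case: eqP => [xE|]; [move: vx; rewrite xE eqxx|rewrite muln0].
Qed.

Definition add_parts (k v : nat) (l : seq nat) : seq nat :=
  sort geq (nseq k v ++ l).

Lemma geq_total : total geq. Proof. by move=> x y; exact: leq_total. Qed.
Lemma geq_trans : transitive geq.
Proof. by move=> x y z xy yz; exact: leq_trans yz xy. Qed.
Lemma geq_anti : antisymmetric geq.
Proof. by move=> x y /andP[xy yx]; apply/anti_leq/andP. Qed.

(** Inserting k copies of v is a bijection from the partitions of n - k v onto those of n with at
    least k copies of v. *)
Lemma partition_number_add_parts n k v : (0 < v)%N ->
  count (fun l => k <= count_mem v l)%N (fset_set (partitions_of n)) =
  if (k * v <= n)%N then partition_number (n - k * v) else 0%N.
Proof.
move=> v0; case: ifPn => kvn; last first.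
  apply/eqP; rewrite -leqn0 leqNgt -has_count; apply/hasPn => l.
  rewrite mem_partitions => /andP[_ /eqP ln]; apply: contra kvn => kl.
  rewrite -ln; move: kl; elim: l k {ln} => [|x l IH] k /=; first by rewrite leqn0 => /eqP->.
  have [->|xv] := eqVneq x v; last by rewrite add0n => /IH; lia.
  by case: k => // k; rewrite add1n ltnS => /IH; rewrite mulSn leq_add2l.
have nseq0 : 0%N \notin nseq k v by rewrite mem_nseq eq_sym (gtn_eqF v0) andbF.
have add_inj : {in fset_set (partitions_of (n - k * v)) &, injective (add_parts k v)}.
  move=> l l'; rewrite !mem_partitions => /andP[/andP[sl _] _] /andP[/andP[sl' _] _].
  move=> /(perm_sortP geq_total geq_trans geq_anti).
  by rewrite perm_cat2l; exact: sorted_eq geq_trans geq_anti _ _ sl sl'.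
rewrite -size_filter.
transitivity (size (map (add_parts k v) (fset_set (partitions_of (n - k * v))))).
  2: by rewrite size_map.
apply: perm_size.
apply: uniq_perm; first by rewrite filter_uniq// fset_uniq.
  by rewrite map_inj_in_uniq ?fset_uniq.
move=> l; rewrite mem_filter mem_partitions; apply/idP/mapP.
  move=> /and3P[kl /andP[sl l0] /eqP ln].
  (* Up to order, [l'] is [l] with k copies of v removed. *)
  pose l' := [seq x <- l | x != v] ++ nseq (count_mem v l - k) v.
  have pl : perm_eq l (nseq k v ++ l').
    rewrite perm_sym /l' perm_catCA -nseqD subnKC//.
    have -> : nseq (count_mem v l) v = [seq x <- l | predC (fun y => y != v) x].
      apply/esym; rewrite (eq_filter (_ : _ =1 pred1 v)); last first.
        by move=> x /=; rewrite negbK.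
      by rewrite -size_filter; apply/all_pred1P/allP => x; rewrite mem_filter => /andP[].
    by rewrite perm_filterC.
  exists (sort geq l').
    rewrite mem_partitions /is_partition (sort_sorted geq_total) ?mem_sort//=.
    rewrite (_ : 0%N \notin l'); last first.
      by move: l0; rewrite (perm_mem pl) mem_cat negb_or => /andP[].
    rewrite (perm_sumn (permEl (perm_sort _ _))).
    by move: ln; rewrite (perm_sumn pl) sumn_cat sumn_nseq => <-; apply/eqP; lia.
  apply: (sorted_eq geq_trans geq_anti) => //; first exact/sort_sorted/geq_total.
  rewrite (perm_trans pl)// perm_sym (permPl (permEl (perm_sort _ _))).
  by rewrite perm_cat2l perm_sort.
move=> [l' + ->]; rewrite mem_partitions => /andP[/andP[sl' l0'] /eqP ln'].
have pl : perm_eq (add_parts k v l') (nseq k v ++ l') by rewrite perm_sort.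
rewrite (permP pl) count_cat count_nseq/= eqxx mul1n leq_addr/=.
rewrite /is_partition (sort_sorted geq_total)//= (perm_mem pl) mem_cat negb_or nseq0 l0'/=.
by rewrite (perm_sumn pl) sumn_cat sumn_nseq ln' mulnC subnKC.
Qed.

(** Double counting of the sum of |l| over all partitions l of n. *)
Lemma partition_number_rec n K V : (n <= K)%N -> (n <= V)%N ->
  (n * partition_number n = \sum_(k < K) \sum_(v < V | k.+1 * v.+1 <= n)
    v.+1 * partition_number (n - k.+1 * v.+1))%N.
Proof.
move=> nK nV; set A := fset_set (partitions_of n).
have -> : (n * partition_number n = \sum_(l <- A) sumn l)%N.
  rewrite big_seq (eq_bigr (fun=> n)) -?big_seq ?big_const_seq ?count_predT ?iter_addn_0 //.
  by move=> l; rewrite mem_partitions => /andP[_ /eqP].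
rewrite big_seq (eq_bigr (fun l => \sum_(k < K) \sum_(v < V)
    v.+1 * (k < count_mem v.+1 l)))%N; last first.
  move=> l; rewrite mem_partitions => /andP[/andP[_ l0] /eqP ln].
  by apply: sumn_count; rewrite ?ln.
rewrite -big_seq exchange_big/=; apply: eq_bigr => k _.
rewrite exchange_big/= [RHS]big_mkcond/=; apply: eq_bigr => v _.
rewrite -big_distrr/=.
have -> : (\sum_(l <- A) (k < count_mem v.+1 l) =
          count (fun l => k < count_mem v.+1 l) A)%N.
  by rewrite -sum1_count [RHS]big_mkcond; apply: eq_bigr => l _; case: ltnP.
rewrite partition_number_add_parts//.
by case: ifP; rewrite ?muln0.
Qed.

Lemma partition_number_gt0 n : (0 < partition_number n)%N.
Proof.
rewrite /partition_number cardfs_gt0; apply/fset0Pn; exists (nseq n 1%N).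
rewrite mem_partitions /is_partition sumn_nseq mul1n eqxx andbT mem_nseq andbF andbT.
by apply/(sortedP 0%N) => i; rewrite size_nseq => i1; rewrite !nth_nseq i1 (ltnW i1).
Qed.

Lemma partition_number0 : partition_number 0 = 1%N.
Proof.
rewrite /partition_number (_ : fset_set _ = [fset [::]])%fset ?cardfs1//.
apply/fsetP => l; rewrite mem_partitions in_fset1; apply/andP/eqP; last by move=> ->.
case: l => // x l [/andP[_ /[!inE]/norP[x0 _]] /=].
by rewrite addn_eq0 eq_sym (negPf x0).
Qed.

(** * Node moves *)

Definition small_tail (s t : nat) : seq nat := nseq s 2 ++ nseq t 1.

(** Concatenation replaces the row index, so that inductions on the leading rows go through; [x.+2]
    records that the row is longer than one, and the default of [head] covers the last row. *)
Lemma node_moveP l l' : node_move l l' ->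
  exists l1 x l2, [/\ l = l1 ++ x.+2 :: l2, (head 0 l2 < x.+2)%N &
    l' = rcons (l1 ++ x.+1 :: l2) 1].
Proof.
move=> [i [il nn n1 ->]]; exists (take i l), (nth 0 l i).-2, (drop i.+1 l).
have nE : (nth 0 l i).-2.+2 = nth 0 l i by case: (nth 0 l i) n1 => [|[]].
split; first by rewrite nE -drop_nth// cat_take_drop.
  by rewrite nE -nth0 nth_drop addn0.
by rewrite set_nthE il; case: (nth 0 l i) n1 => [|[]].
Qed.

Lemma node_move_decr l1 x l2 : (head 0 l2 < x.+2)%N ->
  node_move (l1 ++ x.+2 :: l2) (rcons (l1 ++ x.+1 :: l2) 1).
Proof.
move=> x2; have nE k : nth 0%N (l1 ++ x.+2 :: l2) (size l1 + k) = nth 0%N (x.+2 :: l2) k.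
  by rewrite nth_cat ltnNge leq_addr/= addKn.
have := nE 0%N; rewrite addn0 => nE0; exists (size l1).
rewrite -[(size l1).+1]addn1 nE nE0 /= nth0 size_cat/=; split=> //; first by lia.
rewrite set_nthE size_cat/= addnS ltnS leq_addr take_size_cat//.
by rewrite -[l1 ++ x.+2 :: l2]cat_rcons drop_size_cat// size_rcons.
Qed.

Lemma node_move_sumn l l' : node_move l l' -> sumn l' = sumn l.
Proof.
move=> /node_moveP[l1 [x [l2 [-> _ ->]]]].
by rewrite -cats1 !sumn_cat /=; lia.
Qed.

Lemma rcons_nseq1 t : rcons (nseq t 1%N) 1%N = nseq t.+1 1%N.
Proof. by elim: t => //= t ->. Qed.

(** Only the last 2 can move; it becomes a 1 and another 1 is appended. *)
Lemma node_move_small_tail s t l' : node_move (small_tail s t) l' ->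
  exists s' t', l' = small_tail s' t'.
Proof.
move=> /node_moveP[l1 [x [l2 [+ + ->]]]] {l'}; rewrite /small_tail.
elim: s l1 => [|s IH] [|a l1] /=.
- by case: t.
- move=> lE; have : x.+2 \in nseq t 1%N by rewrite lE inE mem_cat mem_head !orbT.
  by rewrite mem_nseq andbC.
- move=> [<- <-]; case: s {IH} => // _; exists 0%N, t.+2.
  by rewrite /= rcons_nseq1.
- move=> [<- lE] x2; have [s' [t' ->]] := IH _ lE x2.
  by exists s'.+1, t'.
Qed.

Lemma leq_all2_refl (h : seq nat) : all2 leq h h.
Proof. by elim: h => //= x h ->; rewrite leqnn. Qed.

Lemma leq_all2_trans (h1 h2 h3 : seq nat) :
  all2 leq h1 h2 -> all2 leq h2 h3 -> all2 leq h1 h3.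
Proof.
elim: h1 h2 h3 => [|x h1 IH] [|y h2] [|z h3] //= /andP[xy h12] /andP[yz h23].
by rewrite (leq_trans xy yz) (IH h2).
Qed.

Lemma leq_all2_sumn (h1 h2 : seq nat) :
  all2 leq h1 h2 -> (sumn h1 <= sumn h2)%N.
Proof.
by elim: h1 h2 => [|x h1 IH] [|y h2] //= /andP[xy /IH]; exact: leq_add.
Qed.

Lemma leq_all2_size (h1 h2 : seq nat) : all2 leq h1 h2 -> size h1 = size h2.
Proof. by rewrite all2E => /andP[/eqP]. Qed.

(** A move inside [h] shortens one of its rows and adds a 1 to the tail; a move inside the tail
    leaves [h] alone. *)
Lemma node_move_cat_small_tail h s t l' : node_move (h ++ small_tail s t) l' ->
  exists h' s' t', l' = h' ++ small_tail s' t' /\ all2 leq h' h.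
Proof.
elim: h l' => [|a h IH] l'.
  by move=> /node_move_small_tail[s' [t' ->]]; exists [::], s', t'.
move=> /node_moveP[[|b l1] [x [l2 [/= [ax lE] x2 ->]]]].
  exists (x.+1 :: h), s, t.+1; split; last by rewrite /= ax leqnSn leq_all2_refl.
  by rewrite -lE /small_tail /= !rcons_cat rcons_nseq1.
have [|h' [s' [t' [l'E hh']]]] := IH (rcons (l1 ++ x.+1 :: l2) 1).
  by rewrite lE; exact: node_move_decr.
exists (b :: h'), s', t'; rewrite /= -l'E ax leqnn hh'.
by split.
Qed.

(** The seed [l0] is fixed before its decomposition, so each family of seeds can be cut where it
    suits, possibly with [s = t = 0]. *)
Lemma node_closureP (A : set (seq nat)) l : node_closure A l ->
  exists l0, [/\ A l0, sumn l = sumn l0 & forall h s t,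
    l0 = h ++ small_tail s t ->
    exists h' s' t', l = h' ++ small_tail s' t' /\ all2 leq h' h].
Proof.
elim=> {l} [l Al|l l' _ [l0 [Al0 ll0 hl]] nm].
  exists l; split=> // h s t lE; exists h, s, t.
  by rewrite leq_all2_refl.
exists l0; split=> //; first by rewrite (node_move_sumn nm).
move=> h s t /hl[h' [s' [t' [lE hh']]]].
rewrite lE in nm; have [h2 [s2 [t2 [-> h2h']]]] := node_move_cat_small_tail nm.
by exists h2, s2, t2; split=> //; exact: leq_all2_trans h2h' hh'.
Qed.

(** * Shapes of the descendants of the seeds *)

Lemma is_partition_cat l1 l2 : is_partition (l1 ++ l2) ->
  is_partition l1 /\ is_partition l2.
Proof.
rewrite /is_partition mem_cat negb_or => /andP[s12 /andP[-> ->]].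
have := subseq_sorted geq_trans _ s12 => ss.
by rewrite (ss _ (prefix_subseq _ _)) (ss _ (suffix_subseq _ _)).
Qed.

Lemma is_partition_first_block a l : is_partition (a :: l) ->
  exists j rest, a :: l = nseq j.+1 a ++ rest /\ (head 0 rest < a)%N.
Proof.
elim: l => [|b l IH] /andP[al].
  by rewrite inE => a0; exists 0%N, [::]; rewrite lt0n eq_sym.
rewrite inE negb_or => /andP[a0 bl0]; have /andP[ba bl] : (b <= a)%N && path geq b l by [].
move: ba; rewrite leq_eqVlt => /predU1P[bE|ba]; last by exists 0%N, (b :: l).
rewrite bE in bl bl0 *; have [|j [rest [lE ra]]] := IH; first by rewrite /is_partition/= bl.
by exists j.+1, rest; rewrite lE.
Qed.

Lemma max_removable_content_ge rho i : (i < size rho)%N ->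
  (nth 0 rho i.+1 < nth 0 rho i)%N ->
  (nth 0 rho i)%:Z - i.+1%:Z <= max_removable_content rho.
Proof.
move=> ir ni; rewrite /max_removable_content.
exact: (@le_bigmax_cond _ _ _ _ (Ordinal ir)
  (fun i : 'I_(size rho) => nth 0 rho i.+1 < nth 0 rho i)%N
  (fun i : 'I_(size rho) => (nth 0 rho i)%:Z - i.+1%:Z)).
Qed.

(* The corner of the first block of rho, of size j x rho_1, has content
   rho_1 - j, so |rho| - m <= j - rho_1 + 1 <= |rho| / 2 when rho_1 > 1. *)
Lemma long_first_row_tail m rho : is_partition rho -> rho != [::] ->
  (sumn rho)%:Z + max_removable_content rho - 1 <= m%:Z ->
  (exists t, rho = nseq t 1) \/ (3 * sumn rho <= 2 * (m + sumn rho).+1)%N.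
Proof.
case: rho => // a l lp _; have [j [rest [lE ra]]] := is_partition_first_block lp.
rewrite lE in lp *; have [_ /andP[_ rest0]] := is_partition_cat lp.
have := @max_removable_content_ge (nseq j.+1 a ++ rest) j.
rewrite !nth_cat size_cat !size_nseq ltnn ltnSn subnn nth0 nth_nseq ltnSn.
rewrite addSn ltnS leq_addr => /(_ isT ra) Cge mge.
have [a2|] := ltnP 1 a; last first.
  case: a ra {lE lp Cge mge} => [|[|//]]; first by [].
  by case: rest rest0 => [|[|//]//] _ _ _; left; exists j.+1; rewrite cats0.
right; have : (j.+1 * 2 <= sumn (nseq j.+1 a ++ rest))%N.
  by rewrite sumn_cat sumn_nseq mulnC (leq_trans _ (leq_addr _ _))// leq_mul2r a2 orbT.
move: (max_removable_content _) (sumn _) Cge mge => C S Cge mge jS.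
lia.
Qed.

(** Four rows hold [p], at most two copies of [q] and at most one [r], as well as the four-row
    families. Long first rows over a column also land here. *)
Definition prefix_form (l : seq nat) :=
  exists h s t, l = h ++ small_tail s t /\ (size h <= 4)%N.

Definition row_form n (l : seq nat) :=
  exists a rho s t, l = a :: rho ++ small_tail s t /\
    (3 * sumn rho <= 2 * n.+1)%N.

Definition box_form n (l : seq nat) :=
  exists a mu k s t, [/\ l = a :: mu ++ small_tail s t,
    all (leq^~ k) mu & (size mu * k <= n)%N].

Lemma seeds_closure_form E17 n l : E17 `<=` partitions_of 17 -> (17 < n)%N ->
  node_closure (seeds E17) l -> sumn l = n -> prefix_form l \/ row_form n l.
Proof.
move=> E17_17 n17 /node_closureP[l0 [sl0 ll0 desc]] ln; rewrite ln in ll0.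
have prefix h s t : (size h <= 4)%N -> l0 = h ++ small_tail s t -> prefix_form l.
  move=> h4 /desc[h' [s' [t' [-> /leq_all2_size hh']]]].
  by exists h', s', t'; rewrite hh'.
case: sl0 => [[[[|]|]|]|].
- move=> [_ [p [q [r [u [v [s [t [u2 v1 l0E]]]]]]]]]; left.
  apply: (prefix (p :: nseq u q ++ nseq v r) s t).
    by rewrite /= size_cat !size_nseq; lia.
  by rewrite l0E /small_tail /= !catA.
- move=> [m _ l0E]; left; apply: (prefix [:: m; 4%N; 3%N; 3%N] 0%N 0%N) => //.
(* Node moves preserve the order, so seeds of order at most 17 have no descendant of order n. *)
- by case=> [[_]|/E17_17[_]]; lia.
- move=> [m [rho [rp rn _ mge l0E]]].
  have [[t rE]|rS] := long_first_row_tail rp rn mge.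
    by left; apply: (prefix [:: m] 0%N t); rewrite // l0E rE.
  (* The whole seed is taken as [h]: the 1s appended by the moves go to the small tail and do not
     count in [rho']. *)
  have [|h' [s' [t' [-> ]]]] := desc (m :: rho) 0%N 0%N; first by rewrite cats0.
  case: h' => // m' rho' /= /andP[_ /leq_all2_sumn rr']; right.
  exists m', rho', s', t'; split=> //.
  by move: ll0; rewrite l0E /= => ->; lia.
- move=> [a [b [_ _ _ l0E]]]; left; exact: (prefix [:: a; b; 3%N; 3%N] 0%N 0%N).
Qed.

(** Rows only decrease, so [mu] stays in the box of its seed, whose area is at most n. *)
Lemma rectangular_closure_form n l :
  node_closure rectangular_tail l -> sumn l = n -> box_form n l.
Proof.
move=> /node_closureP[l0 [[_ [a [k [r [s [t l0E]]]]]] ll0 desc]] ln.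
rewrite ln in ll0.
have [|h' [s' [t' [-> ]]]] := desc (a :: nseq r k) s t; first by rewrite l0E.
case: h' => // a' mu /= /andP[_ muk].
exists a', mu, k, s', t'; rewrite (leq_all2_size muk) size_nseq; split=> //.
  elim: mu r muk {l0E desc} => [|x mu IH] [|r] //= /andP[-> /IH->//].
by rewrite ll0 l0E /= !sumn_cat sumn_nseq mulnC; lia.
Qed.

(** * Counting *)

Definition partitions_upto (N : nat) : seq (seq nat) :=
  flatten [seq enum_fset (fset_set (partitions_of j)) | j <- iota 0 N.+1].

Lemma mem_partitions_upto N l :
  (l \in partitions_upto N) = is_partition l && (sumn l <= N)%N.
Proof.
apply/flatten_mapP/andP => [[j jN]|[lp lN]].
  rewrite mem_partitions => /andP[-> /eqP->].
  by move: jN; rewrite mem_iota.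
by exists (sumn l); rewrite ?mem_partitions ?lp ?eqxx// mem_iota.
Qed.

Lemma size_partitions_upto N :
  size (partitions_upto N) = (\sum_(j < N.+1) partition_number j)%N.
Proof.
rewrite size_flatten /shape -map_comp sumnE big_map -(subn0 N.+1).
by rewrite -/(index_iota 0 N.+1) big_mkord.
Qed.

(* The partition inside the k x r box whose complement, read from the last row
   up, is nu. *)
Definition box_complement (k r : nat) (nu : seq nat) : seq nat :=
  nseq (r - size nu) k ++ [seq (k - x)%N | x <- rev nu].

(** The rows k - x of the complement grow downwards, hence the reversal. Full rows of [mu] leave
    zeros, which are filtered out and restored by the [nseq] block of [box_complement]. *)
Lemma box_complementP k mu : is_partition mu -> all (leq^~ k) mu ->
  exists nu, [/\ is_partition nu, (sumn nu + sumn mu = size mu * k)%N &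
    mu = box_complement k (size mu) nu].
Proof.
move=> /andP[mus _] muk.
pose nu := [seq y <- [seq (k - x)%N | x <- mu] | y != 0%N].
exists (rev nu); split.
- rewrite /is_partition rev_sorted mem_rev mem_filter eqxx/= andbT.
  apply: sorted_filter; first by move=> x y z; exact: leq_trans.
  by rewrite sorted_map; apply: sub_sorted mus => x y /=; exact: leq_sub2l.
- rewrite sumn_rev /nu {mus nu}; elim: mu muk => //= x mu IH /andP[xk /IH].
  by rewrite mulSn => <-; case: ifP => [_|/negbFE/eqP kx]/=; lia.
rewrite /box_complement revK size_rev /nu {nu}.
have sz : (size [seq y <- [seq k - x | x <- mu] | y != 0] <= size mu)%N.
  by rewrite size_filter (leq_trans (count_size _ _))// size_map.
elim: mu mus muk sz => //= x mu IH mus /andP[xk muk].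
have [kx|kx] := eqVneq (k - x)%N 0%N => /=.
  have <- : x = k by lia.
  have xE : x = k by lia.
  have sz : (size [seq y <- [seq k - x | x <- mu] | y != 0] <= size mu)%N.
    by rewrite size_filter (leq_trans (count_size _ _))// size_map.
  by rewrite xE subSn//= -IH// (path_sorted mus).
have all0 : all (fun y => y != 0%N) [seq (k - x)%N | x <- mu].
  apply/allP => _ /mapP[y ymu ->].
  have := allP (order_path_min geq_trans mus) _ ymu; rewrite /=; lia.
rewrite (all_filterP all0) size_map subnn/= subKn// => _; congr cons.
rewrite -map_comp -[LHS]map_id; apply/eq_in_map => y ymu /=.
by rewrite subKn// (allP muk).
Qed.

(* The last two entries of u are the exponents of 2 and 1.  The others are the
   leading parts, padded with zeros, when i = 0; otherwise u starts with the
   first part, followed when i = 2 by the dimensions k, r of the box. *)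
Definition decode (i : nat) (u rho : seq nat) : seq nat :=
  match i with
  | 0 => [seq x <- take 4 u | x != 0%N]
  | 1 => head 0%N u :: rho
  | _ => head 0%N u :: box_complement (nth 0 u 1)%N (nth 0 u 2)%N rho
  end ++ small_tail (nth 0 u 4)%N (nth 0 u 5)%N.

Definition decoded n i l :=
  exists u rho, [/\ size u = 6, all (leq^~ n) u,
    rho \in partitions_upto (2 * n.+1 %/ 3) & l = decode i u rho].

Lemma small_tail_bounds n h s t : sumn (h ++ small_tail s t) = n ->
  [/\ all (leq^~ n) h, (s <= n)%N & (t <= n)%N].
Proof.
move=> <-; split.
- by apply/allP => x xh; apply: leq_sumn_mem; rewrite mem_cat xh.
- by rewrite !sumn_cat !sumn_nseq; lia.
- by rewrite !sumn_cat !sumn_nseq; lia.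
Qed.

Lemma prefix_form_decoded n l :
  is_partition l -> sumn l = n -> prefix_form l -> decoded n 0 l.
Proof.
move=> lp ln [h [s [t [lE h4]]]]; rewrite lE in lp ln *.
have [hn sn tn] := small_tail_bounds ln.
have [/andP[_ h0] _] := is_partition_cat lp.
exists (h ++ nseq (4 - size h) 0%N ++ [:: s; t]), [::]; split.
- by rewrite !size_cat size_nseq/=; lia.
- by rewrite !all_cat hn all_nseq orbT/= sn tn.
- by rewrite mem_partitions_upto.
have sz : size (h ++ nseq (4 - size h) 0%N) = 4 by rewrite size_cat size_nseq subnKC.
rewrite /decode catA take_size_cat// !nth_cat sz/= filter_cat.
rewrite (all_filterP _); last by apply/allP => x; apply: contraTneq => ->.
by rewrite filter_nseq/= cats0.
Qed.

Lemma row_form_decoded n l :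
  is_partition l -> sumn l = n -> row_form n l -> decoded n 1 l.
Proof.
move=> lp ln [a [rho [s [t [lE rn]]]]]; rewrite lE -cat_cons in lp ln *.
have [/andP[an _] sn tn] := small_tail_bounds ln.
have [arp _] := is_partition_cat lp.
have [_ rp] := @is_partition_cat [:: a] rho arp.
exists [:: a; 0; 0; 0; s; t]%N, rho; split=> //; first by rewrite /= an sn tn.
by rewrite mem_partitions_upto rp leq_divRL// mulnC.
Qed.

(** The threshold 2(n + 1)/3 of [row_form] is reused: when [mu] exceeds it, the complement has fewer
    than n / 3 cells. *)
Lemma box_form_decoded n l :
  is_partition l -> sumn l = n -> box_form n l -> decoded n 1 l \/ decoded n 2 l.
Proof.
move=> lp ln [a [mu [k [s [t [lE muk kn]]]]]].
have [mun|mun] := leqP (3 * sumn mu) (2 * n.+1).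
  by left; apply: row_form_decoded => //; exists a, mu, s, t.
right; rewrite lE -cat_cons in lp ln *.
have [/andP[an _] sn tn] := small_tail_bounds ln.
have [amp _] := is_partition_cat lp.
have [_ mup] := @is_partition_cat [:: a] mu amp.
have [nu [nup numu muE]] := box_complementP mup muk.
(* As [mu] has a row, k is at most the area of the box, so it can be an entry of [u]. *)
have mu0 : (0 < size mu)%N by rewrite lt0n; apply: contraTneq mun => /size0nil->.
have mus : (size mu <= n)%N.
  rewrite -ln sumn_cat /=; case/andP: mup => _ /leq_size_sumn; lia.
have kn' : (k <= n)%N by apply: leq_trans kn; rewrite leq_pmull.
exists [:: a; k; size mu; 0; s; t]%N, nu; split=> //.
- by rewrite /= an kn' mus sn tn.
- by rewrite mem_partitions_upto nup leq_divRL// mulnC; lia.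
- by rewrite {1}muE.
Qed.

(** The decodings of all codes cover the counted partitions, and repetitions only lengthen the list:
    there are 3 formats and (n + 1)^6 vectors [u]. *)
Lemma count_decoded (A : set (seq nat)) n :
  (forall l, A l -> is_partition l -> sumn l = n ->
     exists2 i, (i < 3)%N & decoded n i l) ->
  (count_of A n <= 3 * (n.+1 ^ 6 * size (partitions_upto (2 * n.+1 %/ 3))))%N.
Proof.
move=> A_decoded; set Q := partitions_upto _.
have QE : Q = partitions_upto (2 * n.+1 %/ 3) by []; clearbody Q.
pose U := [seq map val (tval u) | u : 6.-tuple 'I_n.+1].
pose E := flatten [seq [seq decode i u rho | u <- U, rho <- Q] | i <- iota 0 3].
have -> : (3 * (n.+1 ^ 6 * size Q))%N = size E.
  rewrite /E [X in _ = size X]/= cats0 !size_cat !size_allpairs /U size_map.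
  rewrite -cardE card_tuple card_ord.
  by lia.
apply: uniq_leq_size; first exact: fset_uniq.
move=> l; rewrite in_fset_set; last first.
  exact: sub_finite_set (@subIsetr _ _ _) (finite_partitions_of n).
rewrite in_setE => -[Al [lp ln]]; have [i i3 [u [rho [su un rQ ->]]]] := A_decoded _ Al lp ln.
apply/flatten_mapP; exists i; first by rewrite mem_iota.
apply/allpairsP; exists (u, rho); split; rewrite ?QE//=.
have su' : size [seq inord x : 'I_n.+1 | x <- u] == 6 by rewrite size_map su.
apply/mapP; exists (Tuple su'); first by rewrite mem_enum.
rewrite /= -map_comp -[LHS]map_id; apply/eq_in_map => x xu /=.
by rewrite inordK// ltnS (allP un).
Qed.

(** * Asymptotics *)

Lemma expR_ge_pow {R : realType} (y : R) j : 0 <= y ->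
  (y / j.+1%:R) ^+ j.+1 <= expR y.
Proof.
move=> y0; have -> : expR y = expR (y / j.+1%:R) ^+ j.+1.
  by rewrite -expRM_natr divfK// pnatr_eq0.
rewrite lerXn2r ?nnegrE ?expR_ge0 ?divr_ge0//.
by apply: le_trans (expR_ge1Dx _); rewrite lerDr.
Qed.

Lemma subexponential_cvg0 {R : realType} (f : nat -> R) (a C : R) (D n0 : nat) :
  0 < a -> 0 < C -> (1 < n0)%N -> (forall n, 0 <= f n) ->
  (forall n, (n0 <= n)%N ->
    f n <= C * n%:R ^+ D * expR (- (a * Num.sqrt n%:R))) ->
  f n @[n --> \oo] --> (0 : R).
Proof.
move=> a_gt0 C_gt0 n0_gt1 f_ge0 f_le.
(* As j + 1 = 2 (D + 1), the power (sqrt n)^(j + 1) = n^(D + 1) beats n^D by a factor n. The factor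
   2 in [C'] passes from 1/n to 1/(n + 1). *)
pose j := (2 * D).+1.
pose C' := C * (j.+1%:R / a) ^+ j.+1 * 2.
apply: (@squeeze_cvgr _ _ _ _ (fun=> 0) (fun n => C' * harmonic n)); last 2 first.
- exact: cvg_cst.
- rewrite -[X in _ --> X](mulr0 C').
  by apply: cvgM; [exact: cvg_cst|exact: cvg_harmonic].
near=> n; rewrite f_ge0/=.
have n0n : (n0 <= n)%N by near: n; exact: nbhs_infty_ge.
have nR : 0 < n%:R :> R by rewrite ltr0n; lia.
have r0 := sqrtr_ge0 (n%:R : R).
apply: le_trans (f_le n n0n) _.
have := expR_ge_pow j (mulr_ge0 (ltW a_gt0) r0).
rewrite mulrAC exprMn (_ : j.+1 = 2 * D.+1)%N; last by rewrite /j; lia.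
rewrite [Num.sqrt _ ^+ _]exprM sqr_sqrtr// -(_ : j.+1 = 2 * D.+1)%N; last first.
  by rewrite /j; lia.
have b0 : 0 < (a / j.+1%:R) ^+ j.+1 by rewrite exprn_gt0// divr_gt0.
have -> : C' = C / (a / j.+1%:R) ^+ j.+1 * 2 by rewrite -exprVn invf_div.
move: ((a / _) ^+ _) b0 => b b0 H; rewrite expRN.
apply: (@le_trans _ _ (C * n%:R ^+ D / (b * n%:R ^+ D.+1))).
  rewrite ler_wpM2l ?mulr_ge0 ?exprn_ge0 ?(ltW C_gt0)// lef_pV2// posrE ?expR_gt0//.
  by rewrite mulr_gt0// exprn_gt0.
have -> : C * n%:R ^+ D / (b * n%:R ^+ D.+1) = C / b / n%:R.
  by rewrite exprS; field; rewrite expf_neq0 ?gt_eqF.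
rewrite -[leRHS]mulrA ler_wpM2l ?divr_ge0 ?(ltW C_gt0) ?(ltW b0)//.
rewrite ler_pdivlMr// mulrC ler_pdivrMr//.
by rewrite -natr1; have : 1 <= n%:R :> R by [rewrite ler1n; lia]; lra.
Unshelve. all: by end_near. Qed.

Lemma subexponential_bigO {R : realType} (f : nat -> R) (a C : R) (D n0 : nat) :
  0 < C -> (1 < n0)%N -> (forall n, f n <= 1) ->
  (forall n, (n0 <= n)%N ->
    f n <= C * n%:R ^+ D * expR (- (a * Num.sqrt n%:R))) ->
  exists2 e : nat -> R,
  e =O_\oo (fun n => ln n%:R) &
  forall n, f n <= expR (- a * Num.sqrt n%:R + e n).
Proof.
move=> C_gt0 n0_gt1 f_le1 f_le.
(* Below [n0] the error cancels the exponent and leaves f n <= 1; from [n0] on it is the logarithm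
   of C n^D. *)
exists (fun n => if (n < n0)%N then a * Num.sqrt n%:R else ln C + D%:R * ln n%:R).
  apply/eqO_exP; exists (`|ln C| / ln 2 + D%:R + 1).
    by rewrite ltr_wpDl// addr_ge0// divr_ge0// ln_ge0// ler1n.
  near=> n; have n0n : (n0 <= n)%N by near: n; exact: nbhs_infty_ge.
  have l2 : 0 < ln 2 :> R by rewrite ln_gt0// ltr1n.
  have l2n : ln 2 <= ln n%:R :> R by rewrite ler_ln ?posrE ?ltr0n ?ler_nat//; lia.
  have ln0 : 0 <= ln n%:R :> R by rewrite (le_trans _ l2n)// ltW.
  rewrite ltnNge n0n/= (ger0_norm ln0); apply: le_trans (ler_normD _ _) _.
  rewrite normrM (ger0_norm ln0) normr_nat !mulrDl mul1r.
  rewrite -[leLHS]addr0 !lerD// mulrAC -mulrA ler_peMr//.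
  by rewrite ler_pdivlMr// mul1r.
move=> n; case: ltnP => [_|n0n].
  by rewrite mulNr addNr expR0.
have nR : 0 < n%:R :> R by rewrite ltr0n; lia.
rewrite mulNr addrC !expRD lnK ?posrE// expRM_natl lnK ?posrE//.
exact: f_le.
Unshelve. all: by end_near. Qed.

Lemma count_of_le_partition_number (A : set (seq nat)) n :
  (count_of A n <= partition_number n)%N.
Proof.
rewrite /count_of /partition_number; apply: fsubset_leq_card.
rewrite -fset_set_sub; [exact: subIsetr| |exact: finite_partitions_of].
exact: sub_finite_set (@subIsetr _ _ _) (finite_partitions_of n).
Qed.

Lemma partition_ratio_le {R : realType} : exists D, exists2 C : R, 0 < C &
  forall (A : set (seq nat)) n, (1 < n)%N ->
  (forall l, A l -> is_partition l -> sumn l = n ->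
     exists2 i, (i < 3)%N & decoded n i l) ->
  partition_ratio R A n <= C * n%:R ^+ D *
    expR (- (pi * (Num.sqrt (2 / 3) - 2 / 3) * Num.sqrt n%:R)).
Proof.
have [z [leHz lezH pi_z]] := @exists_zeta2 R.
have z0 : 0 < z by apply: lt_le_trans pi_z; rewrite divr_gt0 ?exprn_gt0 ?pi_gt0.
pose w := Num.sqrt z; have w0 : 0 < w by rewrite sqrtr_gt0.
have wz : w ^+ 2 = z by rewrite sqr_sqrtr// ltW.
have [B [c c0 lowB]] := erdos_lower partition_number_rec w0 wz leHz lezH partition_number_gt0.
have upB n := erdos_upper partition_number_rec w0 wz leHz n partition_number0.
(* B comes from the lower bound on p(n), 6 from the entries of a code and 1 from the number of sizes
   up to [N]; e^(2w) pays for sqrt N <= q r + 1. *)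
exists (B + 7)%N, (3 * 2 ^+ 7 * expR (2 * w) / c).
  by rewrite divr_gt0// !mulr_gt0 ?exprn_gt0 ?expR_gt0.
move=> A n n1 A_dec; set r := Num.sqrt n%:R.
have nR : 0 < n%:R :> R by rewrite ltr0n; lia.
pose q : R := Num.sqrt (2 / 3).
have q0 : 0 <= q by exact: sqrtr_ge0.
have q2 : q ^+ 2 = 2 / 3 by rewrite sqr_sqrtr// divr_ge0.
have r0 : 0 <= r by exact: sqrtr_ge0.
have rn : r ^+ 2 = n%:R by rewrite sqr_sqrtr.
have q1 : q <= 1 by rewrite -(@ler_sqr R) ?nnegrE// q2; lra.
set N := (2 * n.+1 %/ 3)%N.
have N_n : (N.+1 <= 2 * n)%N by rewrite /N; lia.
have sqrtN : Num.sqrt N%:R <= q * r + 1 :> R.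
  rewrite -(@ler_sqr R) ?nnegrE ?addr_ge0 ?mulr_ge0 ?sqrtr_ge0// sqr_sqrtr//.
  have : N%:R * 3 <= 2 * (n%:R + 1) :> R.
    by rewrite natr1 -!natrM ler_nat /N; lia.
  have : 0 <= q * r by rewrite mulr_ge0.
  rewrite sqrrD exprMn q2 rn; lra.
have cnt : (count_of A n)%:R <=
    3 * (2 ^+ 7 * n%:R ^+ 7) * (expR (2 * w) * expR (2 * w * q * r)) :> R.
  apply: (@le_trans _ _ (3 * (n.+1%:R ^+ 6 * (size (partitions_upto N))%:R))).
    by rewrite -natrX -!natrM ler_nat count_decoded.
  have szN : (size (partitions_upto N))%:R <=
      (2 * n%:R) * (expR (2 * w) * expR (2 * w * q * r)) :> R.
    apply: (@le_trans _ _ (N.+1%:R * (expR (2 * w) * expR (2 * w * q * r)))).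
      rewrite size_partitions_upto natr_sum.
      rewrite -[N.+1 in leRHS]card_ord -sumr_const mulr_suml ler_sum// => j _.
      rewrite mul1r; apply: le_trans (upB _) _; rewrite -expRD ler_expR.
      rewrite -[leRHS](_ : 2 * w * (q * r + 1) = _); last by ring.
      rewrite ler_wpM2l ?mulr_ge0 ?(ltW w0)//; apply: le_trans sqrtN.
      by rewrite ler_wsqrtr// ler_nat -ltnS.
    by rewrite -natrM ler_wpM2r ?mulr_ge0 ?expR_ge0// ler_nat.
  have -> : 3 * (2 ^+ 7 * n%:R ^+ 7) * (expR (2 * w) * expR (2 * w * q * r)) =
      3 * ((2 * n%:R) ^+ 6 * (2 * n%:R * (expR (2 * w) * expR (2 * w * q * r)))).
    by ring.
  rewrite ler_wpM2l//; apply: ler_pM => //.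
  have n2 : n.+1%:R <= 2 * n%:R :> R by
    rewrite -natrM ler_nat mul2n -addnn -addn1 leq_add2l ltnW.
  by apply: lerXn2r; rewrite ?nnegrE ?mulr_ge0.
have low := lowB n (ltnW n1).
have p0 : 0 < (partition_number n)%:R :> R by rewrite ltr0n partition_number_gt0.
rewrite /partition_ratio ler_pdivrMr//; apply: le_trans cnt _.
set E := expR (- _).
have E0 : 0 < E by exact: expR_gt0.
(* The bound zeta(2) >= pi^2/6 enters here as pi q <= 2 w, multiplied by r (1 - q) >= 0. *)
have wE : expR (2 * w * q * r) <= E * expR (2 * w * r).
  rewrite -expRD ler_expR -/q -/r.
  have : pi * q <= 2 * w.
    rewrite -(@ler_sqr R) ?nnegrE ?mulr_ge0 ?pi_ge0 ?(ltW w0)//.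
    by rewrite !exprMn q2 wz (_ : 2 ^+ 2 = 4 :> R); [lra|rewrite -natrX].
  have := mulr_ge0 r0 (_ : 0 <= 1 - q); rewrite subr_ge0 => /(_ q1) rq.
  move=> /(ler_wpM2r rq).
  have -> : pi * q * (r * (1 - q)) = pi * (q - q ^+ 2) * r by ring.
  by rewrite q2; lra.
apply: (@le_trans _ _ (3 * 2 ^+ 7 * expR (2 * w) / c * n%:R ^+ (B + 7) * E *
   (c * (expR (2 * w * r) / n%:R ^+ B)))); last first.
  rewrite ler_wpM2l// !mulr_ge0 ?divr_ge0 ?exprn_ge0 ?expR_ge0 ?invr_ge0 ?(ltW c0)//.
have -> : 3 * 2 ^+ 7 * expR (2 * w) / c * n%:R ^+ (B + 7) * E *
   (c * (expR (2 * w * r) / n%:R ^+ B)) =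
   3 * (2 ^+ 7 * n%:R ^+ 7) * (expR (2 * w) * (E * expR (2 * w * r))).
  by rewrite exprD; field; rewrite expf_neq0 ?gt_eqF.
by rewrite ler_wpM2l ?mulr_ge0 ?exprn_ge0// ler_wpM2l ?expR_ge0.
Qed.

Theorem theorem10p1 (R : realType) (E17 : set (seq nat))
    (hE17 : E17 `<=` partitions_of 17) :
  let S := node_closure (seeds E17) in
  let S' := S `|` node_closure rectangular_tail in
  let bound (A : set (seq nat)) :=
    exists2 e : nat -> R,
      e =O_\oo (fun n => ln n%:R) &
      forall n, partition_ratio R A n <=
        expR (- pi * (Num.sqrt (2 / 3) - 2 / 3) * Num.sqrt n%:R + e n) in
  [/\ partition_ratio R S n @[n --> \oo] --> (0 : R),
      bound S,
      partition_ratio R S' n @[n --> \oo] --> (0 : R) &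
      bound S'].
Proof.
move=> S S' bound; have [D [C C0 ratio_le]] := @partition_ratio_le R.
pose a : R := pi * (Num.sqrt (2 / 3) - 2 / 3).
have a0 : 0 < a.
  rewrite mulr_gt0 ?pi_gt0// subr_gt0.
  rewrite -(@ltr_pXn2r _ 2) ?nnegrE ?sqrtr_ge0 ?divr_ge0// sqr_sqrtr ?divr_ge0//.
  by rewrite expr2; lra.
have S'_decoded n l : (17 < n)%N -> S' l -> is_partition l -> sumn l = n ->
    exists2 i, (i < 3)%N & decoded n i l.
  move=> n17 S'l lp ln; case: S'l => [Sl|Tl].
    have [pl|rl] := seeds_closure_form hE17 n17 Sl ln.
      by exists 0%N => //; exact: prefix_form_decoded.
    by exists 1%N => //; exact: row_form_decoded.
  have [d|d] := box_form_decoded lp ln (rectangular_closure_form Tl ln).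
    by exists 1%N.
  by exists 2%N.
(* As S is contained in S', a bound for all subsets of S' gives the four conclusions. *)
have main A : A `<=` S' ->
    partition_ratio R A n @[n --> \oo] --> (0 : R) /\ bound A.
  move=> AS'.
  have r_ge0 n : 0 <= partition_ratio R A n by rewrite divr_ge0.
  have r_le1 n : partition_ratio R A n <= 1.
    rewrite ler_pdivrMr ?ltr0n ?partition_number_gt0// mul1r ler_nat.
    exact: count_of_le_partition_number.
  have r_le n : (18 <= n)%N -> partition_ratio R A n <=
      C * n%:R ^+ D * expR (- (a * Num.sqrt n%:R)).
    move=> n18; apply: ratio_le; first by lia.
    by move=> l /AS' S'l; exact: S'_decoded.
  split; first exact: (subexponential_cvg0 a0 C0 _ r_ge0 r_le).
  rewrite /bound mulNr; exact: (subexponential_bigO C0 _ r_le1 r_le).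
have [cS bS] := main S (@subsetUl _ _ _).
by have [cS' bS'] := main S' (@subset_refl _ _).
Qed.
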